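(* Let $\Delta\ge3$ be an integer, and for a positive integer $d$, $K\in(0,1)$ and an angle $\phi$ let \[f(d,K,\phi)=\max\Big(2\sin(\phi/2),\ \sqrt{1+(1+K)^{-2d}-2\cos(\phi)(1+K)^{-d}}\Big).\] Suppose $k>\Delta$ is an integer and $0<\varepsilon<1$ are such that there exists $K\in(0,1)$ with $\theta:=\arcsin(K)\in\big(0,\frac{\pi}{3(\Delta-1+\varepsilon)}\big)$ satisfying, with $b:=\Delta-d$, \[\frac{(1+\varepsilon)^2(1+K)^d}{\cos((d+b\varepsilon)\theta/2)(k-b)-\varepsilon b(1+K)^d}\le K\quad\text{for } d=0,\dots,\Delta-2,\] \[\frac{(1+\varepsilon)(1+K)^d}{\cos((d+b\varepsilon)\theta/2)(k-b)-\varepsilon b(1+K)^d}\le \frac{K}{f(d,K,(d+b\varepsilon)\theta)}\quad\text{for } d=0,\dots,\Delta-1.\] Let $G=(V,E)$ be any graph of maximum degree at most $\Delta$ and $(w_e)_{e\in E}$ complex weights such that for each $e$ either (i) $|w_e|\le\varepsilon$, or (ii) $|\arg(w_e)|\le\varepsilon\theta$ and $\varepsilon<|w_e|\le1$. Then, with $\mathbf{Z}^W_L(G)$ the restricted partition function with $k$ colours and these weights: (A') For every list $W$ of distinct vertices forming a leaf-independent set and every colour list $L$ with $|L|=|W|$, $\mathbf{Z}^W_L(G)\ne0$. (B') For every list $W=W'u$ of distinct vertices forming a leaf-independent set and any colour lists $L'\ell$, $L'\ell'$ of length $|W|$: (i) the angle between $\mathbf{Z}^{W'u}_{L'\ell}(G)$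 and $\mathbf{Z}^{W'u}_{L'\ell'}(G)$ is at most $\theta$; (ii) $|\mathbf{Z}^{W'u}_{L'\ell}(G)|/|\mathbf{Z}^{W'u}_{L'\ell'}(G)|\le1+K$. (C') For every list $W=W'u$ of distinct vertices with $W'$ a leaf-independent set in $G$, and every colour list $L'$ of length $|W'|$: let $\mathcal{G},\mathcal{N}$ be the sets of good and neutral colours for $u$ with respect to $(G,W',L',\varepsilon)$, $d$ the number of free neighbours of $u$, $b=\Delta-d$, and $m(\ell)$ the number of fixed bad neighbours of $u$ with pre-assigned colour $\ell$. Then (i) $\mathbf{Z}^{W'u}_{L'\ell}(G)\ne0$ for all $\ell\in\mathcal{G}\cup\mathcal{N}$; (ii) for all $\ell,\ell'\in\mathcal{G}\cup\mathcal{N}$ the angle between $\mathbf{Z}^{W'u}_{L'\ell}(G)$ and $\mathbf{Z}^{W'u}_{L'\ell'}(G)$ is at most $(d+b\varepsilon)\theta$; (iii) for all $\ell\in[k]$ and $j\in\mathcal{G}$, $|\mathbf{Z}^{W'u}_{L'\ell}(G)|/|\mathbf{Z}^{W'u}_{L'j}(G)|\le\varepsilon^{m(\ell)}(1+K)^d$.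
   Context: Graphs are simple; $[k]=\{1,\dots,k\}$. For a graph $G=(V,E)$ with complex edge weights $(w_e)$, a list $W=w_1\dots w_m$ of distinct vertices and a list $L=\ell_1\dots\ell_m$ of colours in $[k]$, the restricted partition function is \[\mathbf{Z}^W_L(G)=\sum_{\phi:V\to[k],\ \phi(w_i)=\ell_i\ \forall i}\ \prod_{uv\in E,\ \phi(u)=\phi(v)} w_{uv}.\] $W'u$ and $L'\ell$ denote concatenation of lists. Vertices in $W$ are called fixed (with colour given by $L$); other vertices are free. A set $W\subseteq V$ is leaf-independent if it is an independent set and every vertex in $W$ has degree exactly $1$. Given $\varepsilon>0$, a neighbour $v$ of $u$ is a bad neighbour if $|w_{uv}|\le\varepsilon$. A colour $\ell$ is good for $u$ if no fixed neighbour of $u$ has colour $\ell$; bad if $u$ has at least one fixed bad neighbour coloured $\ell$; neutral if neither good nor bad. Angles between non-zero complex numbers are taken in $[0,\pi]$. *)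

(* Defs.v *)
From Stdlib Require Import Reals Ratan.
From mathcomp Require Import all_boot.
Open Scope R_scope.

Set Implicit Arguments. Unset Strict Implicit. Unset Printing Implicit Defensive.

Record cplx := mkC { re : R ; im : R }.
Definition C0 : cplx := mkC 0 0.
Definition C1 : cplx := mkC 1 0.
Definition Cadd (z w : cplx) : cplx := mkC (re z + re w) (im z + im w).
Definition Cmul (z w : cplx) : cplx :=
  mkC (re z * re w - im z * im w) (re z * im w + im z * re w).
Definition Cnorm (z : cplx) : R := sqrt (re z * re z + im z * im z).

Definition Cangle (z w : cplx) : R :=
  acos ((re z * re w + im z * im w) / (Cnorm z * Cnorm w)).
(* |arg w| for w <> 0, arg taken in (-pi, pi] : the angle between w and 1 *)
Definition Cabs_arg (w : cplx) : R := Cangle w C1.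

(* A simple graph on vertex set 'I_n given by a symmetric irreflexive
   adjacency relation.  Edge weights are given by w u v, read for u < v;
   wt makes this symmetric. *)
Definition simple_graph (n : nat) (adj : rel 'I_n) : Prop :=
  (forall u v, adj u v = adj v u) /\ (forall u, adj u u = false).

Definition deg (n : nat) (adj : rel 'I_n) (u : 'I_n) : nat := #|[set v | adj u v]|.

Definition max_deg_le (n : nat) (adj : rel 'I_n) (D : nat) : Prop :=
  forall u, (deg adj u <= D)%N.

Definition wt (n : nat) (w : 'I_n -> 'I_n -> cplx) (u v : 'I_n) : cplx :=
  if (u < v)%N then w u v else w v u.

(* Colours [k] = {1..k} are represented by 'I_k = {0..k-1}. *)
Definition Zr (n k : nat) (adj : rel 'I_n) (w : 'I_n -> 'I_n -> cplx)
    (W : seq 'I_n) (L : seq 'I_k) : cplx :=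
  \big[Cadd/C0]_(phi : {ffun 'I_n -> 'I_k} |
      [forall i : 'I_(size W), phi (tnth (in_tuple W) i)
                                  == nth (phi (tnth (in_tuple W) i)) L i])
    \big[Cmul/C1]_(p : 'I_n * 'I_n |
        [&& (p.1 < p.2)%N, adj p.1 p.2 & phi p.1 == phi p.2]) w p.1 p.2.

Definition leaf_independent (n : nat) (adj : rel 'I_n) (W : seq 'I_n) : Prop :=
  (forall x y, x \in W -> y \in W -> adj x y = false) /\
  (forall x, x \in W -> deg adj x = 1%N).

Definition fixed_col (n k : nat) (W' : seq 'I_n) (L' : seq 'I_k) (c0 : 'I_k)
    (v : 'I_n) : 'I_k := nth c0 L' (index v W').

Definition fixed_nb (n : nat) (adj : rel 'I_n) (W' : seq 'I_n) (u v : 'I_n) : bool :=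
  adj u v && (v \in W').

Definition good_col (n k : nat) (adj : rel 'I_n) (W' : seq 'I_n) (L' : seq 'I_k)
    (u : 'I_n) (l : 'I_k) : Prop :=
  forall v, fixed_nb adj W' u v -> fixed_col W' L' l v <> l.

Definition bad_col (n k : nat) (adj : rel 'I_n) (w : 'I_n -> 'I_n -> cplx) (eps : R)
    (W' : seq 'I_n) (L' : seq 'I_k) (u : 'I_n) (l : 'I_k) : Prop :=
  exists v, fixed_nb adj W' u v /\ (Cnorm (wt w u v) <= eps) /\
            fixed_col W' L' l v = l.

Definition neutral_col (n k : nat) (adj : rel 'I_n) (w : 'I_n -> 'I_n -> cplx) (eps : R)
    (W' : seq 'I_n) (L' : seq 'I_k) (u : 'I_n) (l : 'I_k) : Prop :=
  ~ good_col adj W' L' u l /\ ~ bad_col adj w eps W' L' u l.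

Definition n_free_nb (n : nat) (adj : rel 'I_n) (W' : seq 'I_n) (u : 'I_n) : nat :=
  #|[set v | adj u v & v \notin W']|.

Definition m_bad (n k : nat) (adj : rel 'I_n) (w : 'I_n -> 'I_n -> cplx) (eps : R)
    (W' : seq 'I_n) (L' : seq 'I_k) (u : 'I_n) (l : 'I_k) : nat :=
  #|[set v | fixed_nb adj W' u v &
        Rle_dec (Cnorm (wt w u v)) eps && (fixed_col W' L' l v == l)]|.

Definition fdK (d : nat) (K phi : R) : R :=
  Rmax (2 * sin (phi / 2))
       (sqrt (1 + / (1 + K) ^ (2 * d) - 2 * cos phi * / (1 + K) ^ d)).

Definition denom (Delta d k : nat) (eps K theta : R) : R :=
  (cos ((INR d + (INR Delta - INR d) * eps) * theta / 2) * (INR k - (INR Delta - INR d))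
   - eps * (INR Delta - INR d) * (1 + K) ^ d).

(* Main.v *)
From HB Require Import structures.
From Stdlib Require Import Reals Ratan Lra Psatz.
From mathcomp Require Import all_boot.
Require Import Defs.
Set Implicit Arguments. Unset Strict Implicit. Unset Printing Implicit Defensive.
Open Scope R_scope.

(* Freezing a set of vertices that spans no edge turns each fixed vertex into leaves hanging from
   its free neighbours, so Z^W_L is the partition function of the free vertices with a list of
   weighted coloured pendants at each of them. Let a_l be the part of this function in which a
   free vertex u has colour l: removing u gives each of its d free neighbours a pendant of
   colour l, so recolouring these pendants one at a time compares a_l with a_l'. Conversely,
   adding a pendant (x, l) at v changes the sum of the a_j only through (x - 1) a_l. The a_j with j
   not bad lie in a narrow cone, so the sum has modulus at least denom * min |a_j| over good j,
   and the two numerical conditions say exactly that moving the pendant from l to l' perturbs the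
   sum by a relative error of at most K = sin theta. Induction on the number of free vertices
   closes the loop.

   The numerical conditions are divisions, so they only carry information once the denominators
   are known to be positive; this is a consequence of the second condition at d = Delta - 1. *)

(** * Complex numbers *)

Lemma CaddA : associative Cadd.
Proof. by move=> [a b] [c d] [e f]; rewrite /Cadd /=; congr mkC; ring. Qed.

Lemma CaddC : commutative Cadd.
Proof. by move=> [a b] [c d]; rewrite /Cadd /=; congr mkC; ring. Qed.

Lemma Cadd0 : left_id C0 Cadd.
Proof. by move=> [a b]; rewrite /Cadd /=; congr mkC; ring. Qed.

Lemma CmulA : associative Cmul.
Proof. by move=> [a b] [c d] [e f]; rewrite /Cmul /=; congr mkC; ring. Qed.

Lemma CmulC : commutative Cmul.
Proof. by move=> [a b] [c d]; rewrite /Cmul /=; congr mkC; ring. Qed.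

Lemma Cmul1 : left_id C1 Cmul.
Proof. by move=> [a b]; rewrite /Cmul /=; congr mkC; ring. Qed.

Lemma Cmul0l : left_zero C0 Cmul.
Proof. by move=> [a b]; rewrite /Cmul /C0 /=; congr mkC; ring. Qed.

Lemma Cmul0r : right_zero C0 Cmul.
Proof. by move=> z; rewrite CmulC Cmul0l. Qed.

Lemma CmulDl : left_distributive Cmul Cadd.
Proof. by move=> [a b] [c d] [e f]; rewrite /Cmul /Cadd /=; congr mkC; ring. Qed.

Lemma CmulDr : right_distributive Cmul Cadd.
Proof. by move=> z x y; rewrite CmulC CmulDl; congr Cadd; apply: CmulC. Qed.

HB.instance Definition _ := Monoid.isComLaw.Build cplx C0 Cadd CaddA CaddC Cadd0.
HB.instance Definition _ := Monoid.isComLaw.Build cplx C1 Cmul CmulA CmulC Cmul1.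
HB.instance Definition _ := Monoid.isMulLaw.Build cplx C0 Cmul Cmul0l Cmul0r.
HB.instance Definition _ := Monoid.isAddLaw.Build cplx Cmul Cadd CmulDl CmulDr.

Lemma Ceq z w : re z = re w -> im z = im w -> z = w.
Proof. by case: z; case: w => /= a b c d -> ->. Qed.

Definition Csub (z w : cplx) : cplx := mkC (re z - re w) (im z - im w).
Definition polar (r t : R) : cplx := mkC (r * cos t) (r * sin t).

Lemma polarM r s r' t : Cmul (polar r s) (polar r' t) = polar (r * r') (s + t).
Proof. by rewrite /Cmul /polar /= cos_plus sin_plus; congr mkC; ring. Qed.

Lemma polar10 : polar 1 0 = C1.
Proof. by rewrite /polar cos_0 sin_0; congr mkC; ring. Qed.

Lemma Cnorm_ge0 z : 0 <= Cnorm z.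
Proof. exact: sqrt_pos. Qed.

Lemma Cnorm_sqr z : Cnorm z * Cnorm z = re z * re z + im z * im z.
Proof. by apply: sqrt_sqrt; nra. Qed.

Lemma Cnorm_le z x : 0 <= x -> re z * re z + im z * im z <= x * x -> Cnorm z <= x.
Proof.
move=> x0 h; apply: Rsqr_incr_0 => //; last exact: Cnorm_ge0.
by rewrite /Rsqr Cnorm_sqr.
Qed.

Lemma Cnorm0 : Cnorm C0 = 0.
Proof. by rewrite /Cnorm /C0 /= -[RHS]sqrt_0; congr sqrt; ring. Qed.

Lemma Cnorm1 : Cnorm C1 = 1.
Proof. by rewrite /Cnorm /C1 /= -[RHS]sqrt_1; congr sqrt; ring. Qed.

Lemma Cnorm_gt0 z : z <> C0 -> 0 < Cnorm z.
Proof.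
move=> z0; case: (Cnorm_ge0 z) => // h; case: z0.
have := Cnorm_sqr z; rewrite -h; case: z {h} => a b /= h.
by rewrite /C0; congr mkC; nra.
Qed.

Lemma Cnorm_gt0_neq0 z : 0 < Cnorm z -> z <> C0.
Proof. by move=> + e; rewrite e Cnorm0; lra. Qed.

Lemma CnormM z w : Cnorm (Cmul z w) = Cnorm z * Cnorm w.
Proof. by rewrite /Cnorm -sqrt_mult /=; [congr sqrt; ring | nra | nra]. Qed.

Lemma Cnorm_polar r t : 0 <= r -> Cnorm (polar r t) = r.
Proof.
move=> r0; rewrite /Cnorm /= -[RHS](sqrt_square r) //; congr sqrt.
have := sin2_cos2 t; rewrite /Rsqr => h.
by transitivity (r * r * (sin t * sin t + cos t * cos t)); [ring | rewrite h; ring].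
Qed.

Lemma Cmul_neq0 z w : z <> C0 -> w <> C0 -> Cmul z w <> C0.
Proof.
move=> /Cnorm_gt0 z0 /Cnorm_gt0 w0; apply: Cnorm_gt0_neq0; rewrite CnormM.
exact: Rmult_lt_0_compat.
Qed.

Lemma re_le_Cnorm z : re z <= Cnorm z.
Proof. by have := Cnorm_sqr z; have := Cnorm_ge0 z; nra. Qed.

Lemma re_ge_Cnorm z : - Cnorm z <= re z.
Proof. by have := Cnorm_sqr z; have := Cnorm_ge0 z; nra. Qed.

Lemma Cnorm_triang z w : Cnorm (Cadd z w) <= Cnorm z + Cnorm w.
Proof.
have z0 := Cnorm_ge0 z; have w0 := Cnorm_ge0 w.
apply: Cnorm_le; first lra.
have hz := Cnorm_sqr z; have hw := Cnorm_sqr w.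
suff : re z * re w + im z * im w <= Cnorm z * Cnorm w by rewrite /Cadd /=; nra.
apply: Rsqr_incr_0_var; last nra.
have -> : (Cnorm z * Cnorm w)² = (Cnorm z * Cnorm z) * (Cnorm w * Cnorm w).
  by rewrite /Rsqr; ring.
have := Rle_0_sqr (re z * im w - im z * re w).
by rewrite hz hw /Rsqr; nra.
Qed.

Lemma CsubE z w : Csub z w = Cadd z (Cmul (mkC (-1) 0) w).
Proof. by rewrite /Csub /Cadd /Cmul /=; congr mkC; ring. Qed.

Lemma Cnorm_sub z w : Cnorm (Csub z w) <= Cnorm z + Cnorm w.
Proof.
rewrite CsubE; apply: Rle_trans (Cnorm_triang _ _) _; rewrite CnormM.
suff -> : Cnorm (mkC (-1) 0) = 1 by lra.
by rewrite /Cnorm /= -[RHS]sqrt_1; congr sqrt; ring.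
Qed.

Lemma Cnorm_subC z w : Cnorm (Csub z w) = Cnorm (Csub w z).
Proof. by rewrite /Cnorm /Csub /=; congr sqrt; ring. Qed.

Lemma Cdiv_exists z w : w <> C0 -> exists q, z = Cmul q w.
Proof.
move=> /Cnorm_gt0 w0; have hw := Cnorm_sqr w.
have p0 : 0 < re w * re w + im w * im w by rewrite -hw; nra.
exists (mkC ((re z * re w + im z * im w) / (re w * re w + im w * im w))
            ((im z * re w - re z * im w) / (re w * re w + im w * im w))).
by case: z => a b; rewrite /Cmul /=; congr mkC; field; lra.
Qed.

(** [Cabs_arg] is an arc cosine and loses the sign of the argument; the sign of [im z] restores
    it. *)
Lemma polar_exists z : z <> C0 ->
  exists2 t, Rabs t = Cabs_arg z & z = polar (Cnorm z) t.
Proof.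
move=> z0; have n0 := Cnorm_gt0 z0; have hn := Cnorm_sqr z.
set a := Cabs_arg z.
have e : a = acos (re z / Cnorm z).
  rewrite /a /Cabs_arg /Cangle Cnorm1; congr acos; rewrite /C1 /=; field; lra.
have hb : -1 <= re z / Cnorm z <= 1.
  have [l u] := (re_ge_Cnorm z, re_le_Cnorm z).
  split; apply: (Rmult_le_reg_r (Cnorm z)) => //; rewrite /Rdiv Rmult_assoc Rinv_l; lra.
have ca : Cnorm z * cos a = re z by rewrite e cos_acos //; field; lra.
have [a0 api] : 0 <= a <= PI by rewrite e; exact: acos_bound.
have sa0 : 0 <= sin a by apply: sin_ge_0.
have sa : (Cnorm z * sin a) * (Cnorm z * sin a) = im z * im z.
  have := sin2_cos2 a; rewrite /Rsqr => h; nra.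
have sn0 : 0 <= Cnorm z * sin a by nra.
case: (Rle_dec 0 (im z)) => hi.
  exists a; first by rewrite Rabs_pos_eq.
  by apply: Ceq => /=; [lra | nra].
exists (- a); first by rewrite Rabs_Ropp Rabs_pos_eq.
by apply: Ceq => /=; rewrite ?cos_neg ?sin_neg; [lra | nra].
Qed.

(** A multiplicative form of closeness. Along a chain the factors multiply, so the bounds [al] add
    and the bounds [rho] multiply, with no reduction of angles modulo 2 pi. Only at the end is
    [near] converted into [Cangle]. *)
Definition near (al rho : R) (z w : cplx) : Prop :=
  exists r t, 0 < r <= rho /\ Rabs t <= al /\ w = Cmul (polar r t) z.

Lemma near_refl z : near 0 1 z z.
Proof. by exists 1, 0; rewrite polar10 Cmul1 Rabs_R0; split; [lra | split; [lra|]]. Qed.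

Lemma near_trans al rho al' rho' x y z :
  near al rho x y -> near al' rho' y z -> near (al + al') (rho * rho') x z.
Proof.
move=> [r [t [hr [ht ->]]]] [r' [t' [hr' [ht' ->]]]].
exists (r' * r), (t' + t); rewrite CmulA polarM; split; first nra.
by split=> //; have := Rabs_triang t' t; lra.
Qed.

Lemma near_weak al rho al' rho' x y :
  al <= al' -> rho <= rho' -> near al rho x y -> near al' rho' x y.
Proof. by move=> h h' [r [t [hr [ht e]]]]; exists r, t; split; first lra; split; first lra. Qed.

Lemma near_mull q al rho x y : near al rho x y -> near al rho (Cmul q x) (Cmul q y).
Proof.
move=> [r [t [hr [ht ->]]]]; exists r, t; do 2!split=> //.
by rewrite !CmulA (CmulC q).
Qed.

Lemma near_norm al rho x y : near al rho x y -> Cnorm y <= rho * Cnorm x.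
Proof.
move=> [r [t [hr [ht ->]]]]; rewrite CnormM Cnorm_polar; last lra.
by apply: Rmult_le_compat_r; [exact: Cnorm_ge0 | lra].
Qed.

Lemma Cangle_near al rho x y :
  x <> C0 -> al <= PI -> near al rho x y -> Cangle x y <= al.
Proof.
move=> /Cnorm_gt0 x0 hal [r [t [hr [ht ->]]]].
rewrite /Cangle CnormM Cnorm_polar; last lra.
have -> : (re x * re (Cmul (polar r t) x) + im x * im (Cmul (polar r t) x)) /
   (Cnorm x * (r * Cnorm x)) = cos t.
  rewrite /Cmul /polar /=.
  transitivity ((re x * re x + im x * im x) * r * cos t / (Cnorm x * Cnorm x * r)).
    by congr (_ / _); ring.
  by rewrite -Cnorm_sqr; field; lra.
have -> : cos t = cos (Rabs t).
  by rewrite /Rabs; case: Rcase_abs => _ //; rewrite cos_neg.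
by rewrite acos_cos //; split; [exact: Rabs_pos | lra].
Qed.

(** The quotient z / w lies in the disc of radius K about 1. This disc is seen from the origin under
    the half-angle [asin K], and its points have modulus at most 1 + K. *)
Lemma near_of_sub K z w : 0 < K < 1 -> w <> C0 ->
  Cnorm (Csub z w) <= K * Cnorm w -> near (asin K) (1 + K) w z.
Proof.
move=> hK w0 h; have [q e] := Cdiv_exists z w0; have n0 := Cnorm_gt0 w0.
have e1 : Csub z w = Cmul (mkC (re q - 1) (im q)) w.
  by rewrite e; case: (w) => a b; rewrite /Csub /Cmul /=; congr mkC; ring.
have hq : Cnorm (mkC (re q - 1) (im q)) <= K.
  by apply: (Rmult_le_reg_r (Cnorm w)) => //; rewrite -CnormM -e1.
have := Cnorm_sqr (mkC (re q - 1) (im q)); have := Cnorm_ge0 (mkC (re q - 1) (im q)).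
move: hq; set m := Cnorm _ => hq m0 /= hm.
have re0 : 0 < re q by nra.
have q2 := Cnorm_sqr q; have q0 := Cnorm_ge0 q.
have qgt : 0 < Cnorm q by nra.
have re1 : re q - 1 <= K by nra.
have qK : Cnorm q <= 1 + K by apply: Cnorm_le; nra.
(* The sine of the argument of [q] is at most K in absolute value. Once [im q] is eliminated, this
   reduces to (re q - (1 - K^2))^2 >= 0, with equality at the points of tangency. *)
have key : im q * im q <= K * K * (Cnorm q * Cnorm q).
  have im2 : im q * im q <= K * K - (re q - 1) * (re q - 1) by nra.
  have : (1 - K * K) * (im q * im q) <= (1 - K * K) * (K * K - (re q - 1) * (re q - 1)).
    by apply: Rmult_le_compat_l; nra.
  by rewrite q2; have := Rle_0_sqr (re q - (1 - K * K)); rewrite /Rsqr; lra.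
have s2 : Rabs (im q / Cnorm q) <= K.
  rewrite Rabs_mult Rabs_inv (Rabs_pos_eq (Cnorm q)) //.
  apply: (Rmult_le_reg_r (Cnorm q)) => //; rewrite Rmult_assoc Rinv_l ?Rmult_1_r; last lra.
  by apply: Rsqr_incr_0_var; [rewrite -Rsqr_abs /Rsqr; nra | nra].
have [s3 s4] : - K <= im q / Cnorm q <= K by move: s2; rewrite /Rabs; case: Rcase_abs; lra.
set s := im q / Cnorm q in s2 s3 s4.
exists (Cnorm q), (asin s); split; first lra; split.
  have [l1 u1] := asin_bound s; have [l2 u2] := asin_bound K.
  apply: Rabs_le; split; last first.
    by apply: sin_incr_0 => //; rewrite !sin_asin; lra.
  by apply: sin_incr_0; try lra; rewrite sin_neg !sin_asin; lra.
rewrite e; congr Cmul; rewrite /polar sin_asin; last lra.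
rewrite cos_asin; last lra.
have -> : sqrt (1 - s²) = re q / Cnorm q.
  have d0 : 0 <= re q / Cnorm q by apply: Rlt_le; apply: Rdiv_lt_0_compat.
  rewrite -[RHS]sqrt_square //; congr sqrt; rewrite /s /Rsqr.
  have -> : 1 = (Cnorm q * Cnorm q) / (Cnorm q * Cnorm q) by field; lra.
  by rewrite q2 -q2; field_simplify_eq; [rewrite /= ; nra | lra].
by apply: Ceq => /=; rewrite /s; field; lra.
Qed.

(** * Cones and chords *)

Lemma cos_Rabs t : cos (Rabs t) = cos t.
Proof. by rewrite /Rabs; case: Rcase_abs => _ //; rewrite cos_neg. Qed.

Lemma cos_ge_of_Rabs t al : Rabs t <= al <= PI -> cos al <= cos t.
Proof. by move=> h; rewrite -(cos_Rabs t); have t0 := Rabs_pos t; apply: cos_decr_1; lra. Qed.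

(** The law of cosines, where the cosine of the actual angle is at least [cos al] because cosine
    decreases on [0, pi]. *)
Lemma near_chord al rho z w : al <= PI -> near al rho z w ->
  Cnorm (Csub z w) * Cnorm (Csub z w)
    <= Cnorm z * Cnorm z + Cnorm w * Cnorm w - 2 * cos al * (Cnorm z * Cnorm w).
Proof.
move=> hal [r [t [hr [ht ->]]]]; rewrite Cnorm_sqr CnormM Cnorm_polar; last lra.
have := Cnorm_sqr z; have := Cnorm_ge0 z; set m := Cnorm z => m0 hm.
have ct : cos al <= cos t by apply: cos_ge_of_Rabs; lra.
have cs := sin2_cos2 t; rewrite /Rsqr in cs.
rewrite /Csub /Cmul /polar /=.
have h : m * m * r * cos al <= m * m * r * cos t by apply: Rmult_le_compat_l; nra.
have -> : (re z - (r * cos t * re z - r * sin t * im z)) * (re z - (r * cos t * re z - r * sin t * im z)) +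
  (im z - (r * cos t * im z + r * sin t * re z)) * (im z - (r * cos t * im z + r * sin t * re z))
 = (re z * re z + im z * im z) * (1 + r * r * (sin t * sin t + cos t * cos t) - 2 * r * cos t) by ring.
by rewrite cs -hm; lra.
Qed.

(** In a triangle, the side opposite an angle of at most pi / 3 is not longer than both other sides:
    here cos >= 1/2, and x^2 + y^2 - x y <= max(x, y)^2. *)
Lemma near_chord_le_max al rho z w M : al <= PI / 3 -> near al rho z w ->
  Cnorm z <= M -> Cnorm w <= M -> Cnorm (Csub z w) <= M.
Proof.
move=> hal nr hz hw; have pi := PI_RGT_0.
have := near_chord (al := al) (ltac:(lra)) nr.
have [r [t [_ [ht _]]]] := nr; have t0 := Rabs_pos t.
have ch : 1 / 2 <= cos al by rewrite -cos_PI3; apply: cos_decr_1; lra.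
have := Cnorm_ge0 z; have := Cnorm_ge0 w; have := Cnorm_ge0 (Csub z w).
move: hz hw; set x := Cnorm z; set y := Cnorm w; set c := Cnorm _ => hz hw c0 y0 x0 h.
have h1 : 1 / 2 * (x * y) <= cos al * (x * y) by apply: Rmult_le_compat_r; nra.
apply: Rsqr_incr_0_var; last lra; rewrite /Rsqr.
by case: (Rle_dec x y) => hxy; nra.
Qed.

Lemma fdK_sin d K phi : 2 * sin (phi / 2) <= fdK d K phi.
Proof. exact: Rmax_l. Qed.

Lemma fdK_sqr d K phi : 0 < K ->
  1 + / (1 + K) ^ d * / (1 + K) ^ d - 2 * cos phi * / (1 + K) ^ d
    <= fdK d K phi * fdK d K phi.
Proof.
move=> K0.
have := Rmax_r (2 * sin (phi / 2))
       (sqrt (1 + / (1 + K) ^ (2 * d) - 2 * cos phi * / (1 + K) ^ d)).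
rewrite -/(fdK d K phi) mulnC muln2 -addnn pow_add Rinv_mult.
set X := (X in sqrt X) => h; have s0 := sqrt_pos X.
have -> : 1 + / (1 + K) ^ d * / (1 + K) ^ d - 2 * cos phi * / (1 + K) ^ d = X by [].
case: (Rle_dec 0 X) => hX; last by nra.
by have := sqrt_sqrt X hX; nra.
Qed.

Lemma one_sub_cos phi : 2 - 2 * cos phi = (2 * sin (phi / 2)) * (2 * sin (phi / 2)).
Proof.
have -> : cos phi = cos (2 * (phi / 2)) by congr cos; field.
by rewrite cos_2a_sin; ring.
Qed.

(* For a fixed longer side the squared chord is convex in the ratio of the two sides,
   so it is maximal at one of the extreme ratios [1] and [(1 + K) ^ - d]. *)
Lemma near_chord_le_fdK d K phi rho z w M :
  0 < K -> 0 <= phi <= PI -> near phi rho z w ->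
  Cnorm z <= M -> Cnorm w <= M ->
  Cnorm z <= (1 + K) ^ d * Cnorm w -> Cnorm w <= (1 + K) ^ d * Cnorm z ->
  Cnorm (Csub z w) <= fdK d K phi * M.
Proof.
move=> K0 hphi nr hz hw hzw hwz.
have := near_chord (proj2 hphi) nr.
have s0 : 0 <= sin (phi / 2) by apply: sin_ge_0; lra.
have f1 := fdK_sin d K phi; have f2 := fdK_sqr d phi K0; have e2 := one_sub_cos phi.
have q1 : 0 < (1 + K) ^ d by apply: pow_lt; lra.
move: f2; set x := / (1 + K) ^ d => f2.
have x0 : 0 < x by apply: Rinv_0_lt_compat.
have xq : x * (1 + K) ^ d = 1 by apply: Rinv_l; lra.
have q2 : 1 <= (1 + K) ^ d by apply: pow_R1_Rle; lra.
have x1 : x <= 1 by nra.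
have := Cnorm_ge0 z; have := Cnorm_ge0 w.
have aux A B : 0 <= A -> 0 <= B -> B <= A -> x * A <= B ->
  A * A + B * B - 2 * cos phi * (A * B) <= fdK d K phi * fdK d K phi * (A * A).
  move=> A0 B0 BA AB; move: f1 f2 e2; set f := fdK _ _ _; set C := cos phi.
  move=> f1 f2 e2.
  have f3 : 2 - 2 * C <= f * f by rewrite e2; apply: Rmult_le_compat; lra.
  (* The ratio B / A is a convex combination of 1 and x with weights proportional to B - x A and A -
     B. [h2] and [h3] are the two endpoint bounds times their weights, and [h1] is the convexity
     gap. The common factor 1 - x is cancelled below, so x = 1 is treated apart. *)
  have h1 : (A - B) * (B - x * A) >= 0 by nra.
  have h2 : 0 <= (f * f - (2 - 2 * C)) * ((B - x * A) * A) by apply: Rmult_le_pos; nra.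
  have h3 : 0 <= (f * f - (1 + x * x - 2 * C * x)) * ((A - B) * A) by apply: Rmult_le_pos; nra.
  case: (Req_dec x 1) => hx.
    have -> : B = A by nra.
    by nra.
  apply: (Rmult_le_reg_l (1 - x)); first lra.
  by nra.
have main A B c : 0 <= A -> 0 <= B -> A <= M -> B <= M -> A <= (1 + K) ^ d * B -> B <= (1 + K) ^ d * A ->
  c * c <= A * A + B * B - 2 * cos phi * (A * B) -> c <= fdK d K phi * M.
  move=> A0 B0 AM BM AB BA hc.
  have f0 : 0 <= fdK d K phi by lra.
  apply: Rsqr_incr_0_var; last by nra.
  rewrite /Rsqr; apply: Rle_trans hc _.
  have ff : 0 <= fdK d K phi * fdK d K phi by nra.
  case: (Rle_dec B A) => hBA.
    apply: Rle_trans (aux A B A0 B0 hBA _) _.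
      by rewrite -(Rmult_1_l B) -xq Rmult_assoc; apply: Rmult_le_compat_l; lra.
    have : A * A <= M * M by nra.
    by move=> /(Rmult_le_compat_l _ _ _ ff); lra.
  have -> : A * A + B * B - 2 * cos phi * (A * B) = B * B + A * A - 2 * cos phi * (B * A) by ring.
  apply: Rle_trans (aux B A B0 A0 (ltac:(lra)) _) _.
    by rewrite -(Rmult_1_l A) -xq Rmult_assoc; apply: Rmult_le_compat_l; lra.
  have : B * B <= M * M by nra.
  by move=> /(Rmult_le_compat_l _ _ _ ff); lra.
by move=> w0 z0; apply: main.
Qed.

Lemma ex_argmax (T : eqType) (F : T -> R) (x : T) (s : seq T) :
  exists2 i, i \in x :: s & forall j, j \in x :: s -> F j <= F i.
Proof.
elim: s x => [|y s IH] x; first by exists x; rewrite ?mem_head // => j; rewrite inE => /eqP ->; lra.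
have [i hi hm] := IH y; case: (Rle_dec (F x) (F i)) => h.
  exists i; first by rewrite inE hi orbT.
  by move=> j; rewrite inE => /orP [/eqP -> // | /hm].
exists x; first exact: mem_head.
by move=> j; rewrite inE => /orP [/eqP -> | /hm]; lra.
Qed.

Lemma Cmul_cancel x y z : z <> C0 -> Cmul x z = Cmul y z -> x = y.
Proof.
move=> /Cnorm_gt0 z0 e.
have n2 := Cnorm_sqr z; have n0 : 0 < re z * re z + im z * im z by nra.
have conj q : Cmul (Cmul q z) (mkC (re z) (- im z)) =
    mkC (re q * (re z * re z + im z * im z)) (im q * (re z * re z + im z * im z)).
  by rewrite /Cmul /=; congr mkC; ring.
have := conj x; rewrite e conj => -[h1 h2].
by apply: Ceq; nra.
Qed.

(** The difference s - s0 agrees with t only modulo 2 pi. The bound al <= pi / 2 keeps s - s0 within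
    [-pi, pi], where equality of cosines forces equality of absolute values. *)
Lemma polar_diff_le al r s t r0 s0 r1 :
  0 <= al <= PI / 2 -> 0 < r1 -> Rabs s <= al -> Rabs s0 <= al -> Rabs t <= al ->
  0 < r -> 0 < r0 -> polar r s = Cmul (polar r1 t) (polar r0 s0) -> s - s0 <= al.
Proof.
move=> hal r1p hs hs0 ht rp r0p; rewrite polarM => e.
have er : r = r1 * r0.
  rewrite -(@Cnorm_polar r s); last lra.
  by rewrite e Cnorm_polar //; nra.
have r10 : 0 < r1 * r0 by nra.
case: e; rewrite er => /Rmult_eq_reg_l e1 /Rmult_eq_reg_l e2.
have {}e1 := e1 (ltac:(lra)); have {}e2 := e2 (ltac:(lra)).
have ec : cos (s - s0) = cos t.
  rewrite cos_minus e1 e2 -cos_minus; congr cos; ring.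
have ct : cos al <= cos t by apply: cos_ge_of_Rabs; lra.
apply: Rnot_lt_le => h.
have : s - s0 <= PI by move: hs hs0; rewrite /Rabs; do 2!case: Rcase_abs; lra.
move=> h'; have := cos_decreasing_1 al (s - s0); rewrite ec; lra.
Qed.

(* All arguments relative to a base point differ by at most [al], so the bisector of the
   two extreme ones is within [al / 2] of every member. *)
Lemma cone_direction (T : finType) (A : pred T) (a : T -> cplx) (al : R) :
  0 <= al <= PI / 2 -> (forall i, A i -> a i <> C0) ->
  (forall i j, A i -> A j -> exists rho, near al rho (a i) (a j)) ->
  exists2 e, Cnorm e = 1 & forall i, A i -> cos (al / 2) * Cnorm (a i) <= re (Cmul e (a i)).
Proof.
move=> hal a0 pw; case: (pickP A) => [i0 A0|none]; last first.
  by exists C1; [exact: Cnorm1 | move=> i; rewrite none].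
(* The implication sits under the existential, with a dummy pair outside [A], so that moduli and
   arguments can be chosen as a total function [g]. *)
have rel i : exists p : R * R, A i -> 0 < p.1 /\ Rabs p.2 <= al /\ a i = Cmul (polar p.1 p.2) (a i0).
  case: (boolP (A i)) => Ai; last by exists (0, 0).
  by have [rho [r [t [hr [ht e]]]]] := pw _ _ A0 Ai; exists (r, t) => _ /=; split; first lra.
have [g hg] := fin_all_exists rel.
pose s := enum A; have mem_s i : (i \in s) = A i by rewrite mem_enum.
have Es : i0 \in s by rewrite mem_s.
case Ds : s => [|x s']; first by rewrite Ds in Es.
have [imax hmax Hmax] := ex_argmax (fun i => (g i).2) x s'.
have [imin hmin Hmin] := ex_argmax (fun i => - (g i).2) x s'.
move: hmax Hmax hmin Hmin; rewrite -Ds !mem_s => hmax Hmax hmin Hmin.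
have diff : (g imax).2 - (g imin).2 <= al.
  have [p1 [p2 p3]] := hg _ hmax; have [q1 [q2 q3]] := hg _ hmin.
  have [rho [r [t [hr [ht e]]]]] := pw _ _ hmin hmax.
  apply: (@polar_diff_le al (g imax).1 _ t (g imin).1 _ r) => //; first lra.
  by apply: (Cmul_cancel (a0 _ A0)); rewrite -p3 e q3 CmulA.
set c := ((g imax).2 + (g imin).2) / 2.
have n0 := Cnorm_gt0 (a0 _ A0); have n2 := Cnorm_sqr (a i0).
(* The unit number that rotates the base point onto the positive real axis. *)
pose u := mkC (re (a i0) / Cnorm (a i0)) (- im (a i0) / Cnorm (a i0)).
have ua : Cmul u (a i0) = polar (Cnorm (a i0)) 0.
  rewrite /polar cos_0 sin_0 /u /Cmul /=; congr mkC; last by field; lra.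
  transitivity ((Cnorm (a i0) * Cnorm (a i0)) / Cnorm (a i0)); last by field; lra.
  by rewrite n2; field; lra.
have nu : Cnorm u = 1.
  apply: (Rmult_eq_reg_r (Cnorm (a i0))); last lra.
  by rewrite -CnormM ua Cnorm_polar; lra.
exists (Cmul (polar 1 (- c)) u); first by rewrite CnormM nu Cnorm_polar; lra.
move=> i Ai; have [p1 [p2 p3]] := hg _ Ai.
have -> : Cmul (Cmul (polar 1 (- c)) u) (a i) = polar ((g i).1 * Cnorm (a i0)) ((g i).2 - c).
  transitivity (Cmul (polar 1 (- c)) (Cmul (polar (g i).1 (g i).2) (Cmul u (a i0)))).
    by rewrite {1}p3 -!CmulA; congr Cmul; rewrite !CmulA (CmulC u).
  by rewrite ua !polarM; congr polar; ring.
have -> : Cnorm (a i) = (g i).1 * Cnorm (a i0) by rewrite {1}p3 CnormM Cnorm_polar; lra.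
rewrite /polar /= [X in X <= _]Rmult_comm; apply: Rmult_le_compat_l; first nra.
apply: cos_ge_of_Rabs; split; last lra.
have h1 := Hmax i; have h2 := Hmin i; rewrite !mem_s in h1 h2.
have {}h1 := h1 Ai; have {}h2 := h2 Ai.
by apply: Rabs_le; rewrite /c; lra.
Qed.

Lemma re_sum_ge (T : eqType) (s : seq T) (g b : pred T) (e : cplx) (a : T -> cplx) (x y : R) :
  (forall i, g i -> ~~ b i) ->
  (forall i, g i -> x <= re (Cmul e (a i))) ->
  (forall i, b i -> - y <= re (Cmul e (a i))) ->
  (forall i, ~~ b i -> 0 <= re (Cmul e (a i))) ->
  INR (count g s) * x - INR (count b s) * y <= re (Cmul e (\big[Cadd/C0]_(i <- s) a i)).
Proof.
move=> gb hg hb h0; elim: s => [|i s IH]; first by rewrite big_nil Cmul0r /=; lra.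
rewrite big_cons CmulDr /= -!plusE !plus_INR /=.
have := hg i; have := hb i; have := h0 i; have := gb i.
by case: (g i); case: (b i) => /= h1 h2 h3 h4;
  first [by have := h1 isT | have := h4 isT; move: IH | have := h3 isT; move: IH
        | have := h2 isT; move: IH]; rewrite /Cadd /=; lra.
Qed.

(** The sum is projected onto the bisector of the cone spanned by the terms outside [b]. There,
    terms in [g] contribute at least cos(al / 2) M, terms in neither class are nonnegative, and
    terms in [b] cost at most y each. *)
Lemma cone_sum_ge (T : finType) (g b : pred T) (a : T -> cplx) (al M y : R) :
  0 <= al <= PI / 2 -> (forall i, g i -> ~~ b i) ->
  (forall i, ~~ b i -> a i <> C0) ->
  (forall i j, ~~ b i -> ~~ b j -> exists rho, near al rho (a i) (a j)) ->
  (forall i, g i -> M <= Cnorm (a i)) -> (forall i, b i -> Cnorm (a i) <= y) ->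
  INR #|g| * (cos (al / 2) * M) - INR #|b| * y <= Cnorm (\big[Cadd/C0]_i a i).
Proof.
move=> hal gb a0 pw hg hb.
have [e e1 he] := @cone_direction T (predC b) a al hal a0 pw.
have c0 : 0 <= cos (al / 2) by apply: cos_ge_0; lra.
have -> : Cnorm (\big[Cadd/C0]_i a i) = Cnorm (Cmul e (\big[Cadd/C0]_i a i)).
  by rewrite CnormM e1; lra.
apply: Rle_trans (re_le_Cnorm _).
have cg (p : pred T) : #|p| = count p (index_enum T).
  by rewrite -sum1_card -sum1_count.
rewrite !cg; apply: re_sum_ge => // i.
- move=> gi; apply: Rle_trans (he i (gb i gi)).
  by apply: Rmult_le_compat_l => //; apply: hg.
- move=> /hb; have := re_ge_Cnorm (Cmul e (a i)); rewrite CnormM e1; lra.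
move=> nb; apply: Rle_trans (he i nb).
by apply: Rmult_le_pos => //; apply: Cnorm_ge0.
Qed.

(** * Positivity of the denominators *)

Lemma PI_lt_33_10 : PI < 33 / 10.
Proof.
(* Seven terms of the Leibniz series for pi / 4 give an upper bound. *)
have [_] := PI_ineq 3; rewrite /sum_f_R0 /tg_alt /PI_tg /=; lra.
Qed.

Lemma cos_PI6_gt : 43 / 50 < cos (PI / 6).
Proof.
rewrite cos_PI6; have s0 := sqrt_pos 3; have s2 := sqrt_sqrt 3 (ltac:(lra)); nra.
Qed.

Lemma sin_ge_lin y : 0 < y <= PI / 6 -> 43 / 50 * y <= sin y.
Proof.
move=> hy; have [c [+ hc]] := @MVT_cor2 sin cos 0 y (ltac:(lra)) (fun x _ => derivable_pt_lim_sin x).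
rewrite sin_0 => e; have pi := PI_RGT_0.
have : cos (PI / 6) <= cos c by apply: cos_decr_1; lra.
have := cos_PI6_gt; nra.
Qed.

Lemma pow_le_exp x n : 0 <= x -> (1 + x) ^ n <= exp (INR n * x).
Proof.
move=> x0; elim: n => [|n IH]; first by rewrite /= Rmult_0_l exp_0; lra.
rewrite S_INR Rmult_plus_distr_r Rmult_1_l exp_plus Rmult_comm /=.
have := exp_ineq1_le x; have : 0 <= (1 + x) ^ n by apply: pow_le; lra.
by move=> p0 h; apply: Rmult_le_compat; lra.
Qed.

(** Since pi / 3 < 1 + 1/10, the value is at most e times exp(1/10). Here e <= 3, and exp(1/10) <=
    10/9 follows from exp(-1/10) >= 9/10. *)
Lemma exp_PI3_lt : exp (PI / 3) < 17 / 5.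
Proof.
have pi := PI_lt_33_10; have p0 := PI_RGT_0.
apply: Rle_lt_trans (_ : 3 * exp (1 / 10) < _).
  have -> : PI / 3 = 1 + (PI / 3 - 1) by lra.
  rewrite exp_plus; apply: Rmult_le_compat; try exact: Rlt_le (exp_pos _).
    exact: exp_le_3.
  case: (Rle_lt_or_eq_dec (PI / 3 - 1) (1 / 10)) => [|h|->]; try lra.
  by apply: Rlt_le; apply: exp_increasing.
have := exp_ineq1_le (- (1 / 10)); rewrite exp_Ropp => h.
have e0 := exp_pos (1 / 10).
have : exp (1 / 10) * / exp (1 / 10) = 1 by apply: Rinv_r; lra.
nra.
Qed.

(** A negative denominator would make the hypothesis hold for free, so positivity at d = Delta - 1
    comes first, from numerical estimates alone. The hypothesis can then be cleared of its
    denominators, and it yields a lower bound on c (k - 1) strong enough for every d. *)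
Lemma denom_gt0 Delta k eps K d :
  (3 <= Delta)%N -> (Delta < k)%N -> 0 < eps < 1 -> 0 < K < 1 ->
  0 < asin K < PI / (3 * (INR Delta - 1 + eps)) ->
  (1 + eps) * (1 + K) ^ (Delta - 1) / denom Delta (Delta - 1) k eps K (asin K)
    <= K / fdK (Delta - 1) K ((INR (Delta - 1) + (INR Delta - INR (Delta - 1)) * eps) * asin K) ->
  (d <= Delta)%N -> 0 < denom Delta d k eps K (asin K).
Proof.
(* From here on, [D] stands for Delta - 1. *)
case: Delta => // D D2; rewrite ltnS in D2; rewrite subn1 succnK => kD he hK; set th := asin K.
have hS : INR D.+1 = INR D + 1 by exact: S_INR.
rewrite /denom hS => hth.
have -> : INR D + 1 - INR D = 1 by ring.
have rD : 2 <= INR D.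
  have -> : 2 = INR 2 by [].
  by apply: le_INR; apply/leP.
have rk : INR D + 2 <= INR k.
  have -> : INR D + 2 = INR D.+2 by rewrite !S_INR; ring.
  by apply: le_INR; apply/leP.
have {}hth : 0 < th /\ 3 * ((INR D + eps) * th) < PI.
  split; first lra; case: hth => t0 ht.
  have := Rmult_lt_compat_l (3 * (INR D + 1 - 1 + eps)) _ _ (ltac:(lra)) ht.
  have -> : 3 * (INR D + 1 - 1 + eps) * (PI / (3 * (INR D + 1 - 1 + eps))) = PI by field; lra.
  lra.
case: hth => th0 hth.
have pi := PI_RGT_0; have pi33 := PI_lt_33_10.
have Kth : K <= th.
  rewrite -[X in X <= _](sin_asin K); last lra.
  by apply: Rlt_le; apply: sin_lt_x.
rewrite Rmult_1_l; set phi := (INR D + eps) * th.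
have phi0 : 0 < phi by rewrite /phi; nra.
have phi1 : 3 * phi < PI by [].
set q := (1 + K) ^ D; set f := fdK D K phi; set c := cos (phi / 2).
have c1 : 43 / 50 < c.
  by apply: Rlt_le_trans cos_PI6_gt _; apply: cos_decr_1; lra.
have qB : 1 + INR D * K <= q by apply: poly; lra.
have DK : 0 < INR D * K by nra.
have DKphi : INR D * K <= phi by rewrite /phi; nra.
have q3 : eps * q < 43 / 50 * (INR D + 1).
  have q0 : eps * q <= q by nra.
  apply: Rle_lt_trans q0 _.
  (* For D >= 3, q <= exp(D K) < 17/5, which is below 43/50 * 4. For D = 2 that bound is too weak,
     and (1 + K)^2 is estimated directly from 2 K <= phi. *)
  case: (ltngtP 2 D) D2 => // hD _.
    have r3 : 3 <= INR D.
      have -> : 3 = INR 3 by rewrite /=; ring.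
      by apply: le_INR; apply/leP.
    apply: Rle_lt_trans (@pow_le_exp K D _) _; first lra.
    have : exp (INR D * K) <= exp (PI / 3) by apply: Rlt_le; apply: exp_increasing; lra.
    by have := exp_PI3_lt; lra.
  by move: DKphi; rewrite /q -hD /=; nra.
have N0 : 0 < c * (INR k - 1) - eps * 1 * q by nra.
have sphi : 43 / 50 * phi <= 2 * sin (phi / 2) by have := @sin_ge_lin (phi / 2); lra.
have f1 : 43 / 50 * (INR D * K) <= f by have := fdK_sin D K phi; rewrite -/f; lra.
have f0 : 0 < f by lra.
move=> hyp.
have {}hyp : (1 + eps) * q * f <= K * (c * (INR k - 1) - eps * 1 * q).
  have := Rmult_le_compat_r _ _ _ (Rlt_le _ _ (Rmult_lt_0_compat _ _ N0 f0)) hyp.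
  set N := c * _ - _ in N0 *; rewrite -/f -/q.
  have -> : (1 + eps) * q / N * (N * f) = (1 + eps) * q * f by field; lra.
  by have -> : K / f * (N * f) = K * N by field; lra.
(* With x = 1 / q and m = D K the claim is m (1 + x) <= 2 f. For x <= 1/2 the sine term of [fdK]
   suffices. Otherwise its square root term does: f^2 >= (1 - x)^2 + x (2 - 2 cos phi), where 1 - x
   >= m x by Bernoulli and 2 - 2 cos phi >= (43/50 m)^2. *)
have f2 : INR D * K * (q + 1) <= 2 * (q * f).
  have q0 : 0 < q by lra.
  have xq : / q * q = 1 by apply: Rinv_l; lra.
  have := fdK_sqr D phi (proj1 hK); rewrite -/f -/q.
  have x0 : 0 < / q by apply: Rinv_0_lt_compat.
  have x1 : INR D * K * / q <= 1 - / q by nra.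
  set x := / q in xq x0 x1 * => h.
  suff : INR D * K * (1 + x) <= 2 * f by nra.
  have sm : 43 / 50 * (INR D * K) <= 2 * sin (phi / 2) by lra.
  set m := INR D * K in DK f1 x1 h sm *.
  case: (Rle_dec x (1 / 2)) => hx; first by nra.
  have g : m * m * (x * x + 1849 / 2500 * x) <= f * f.
    have e2 := one_sub_cos phi.
    have s2 : 1849 / 2500 * (m * m) <= 2 - 2 * cos phi.
      have -> : 1849 / 2500 * (m * m) = (43 / 50 * m) * (43 / 50 * m) by field.
      by rewrite e2; apply: Rmult_le_compat; lra.
    have x2 : m * x * (m * x) <= (1 - x) * (1 - x) by apply: Rmult_le_compat; nra.
    have x3 : x * (1849 / 2500 * (m * m)) <= x * (2 - 2 * cos phi) by apply: Rmult_le_compat_l; lra.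
    nra.
  have g2 : (1 + x) * (1 + x) <= 4 * (x * x + 1849 / 2500 * x) by nra.
  apply: Rsqr_incr_0_var; last lra; rewrite /Rsqr.
  have : m * m * ((1 + x) * (1 + x)) <= m * m * (4 * (x * x + 1849 / 2500 * x)).
    by apply: Rmult_le_compat_l; nra.
  nra.
move=> dD.
have cle s : 0 <= s <= phi / 2 -> c <= cos s by move=> hs; apply: cos_decr_1; lra.
(* At d = Delta the angle Delta * th exceeds [phi], so [c] gives no bound; but b = 0 leaves only the
   product of a positive cosine and k. *)
case: (leqP d D) => hd; last first.
  have -> : d = D.+1 by apply/eqP; rewrite eqn_leq dD.
  rewrite hS Rminus_diag Rmult_0_l Rmult_0_r Rmult_0_l Rplus_0_r Rminus_0_r !Rminus_0_r.
  apply: Rmult_lt_0_compat; last lra; apply: cos_gt_0; nra.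
have rd : 0 <= INR d <= INR D by split; [exact: pos_INR | apply: le_INR; apply/leP].
have cd : c <= cos ((INR d + (INR D + 1 - INR d) * eps) * th / 2).
  have e0 : 0 <= INR d + (INR D + 1 - INR d) * eps <= INR D + eps by split; nra.
  by apply: cle; rewrite /phi; split; nra.
have pd : 1 <= (1 + K) ^ d <= q.
  by split; [apply: pow_R1_Rle; lra | apply: Rle_pow; [lra | apply/leP]].
set C := cos _ in cd *; set P := (1 + K) ^ d in pd *; set r := INR d in rd *.
have h1 : c * (INR k - (INR D + 1 - r)) <= C * (INR k - (INR D + 1 - r)) by apply: Rmult_le_compat_r; lra.
have h2 : eps * (INR D + 1 - r) * P <= eps * (INR D + 1 - r) * q by apply: Rmult_le_compat_l; nra.
suff : 0 < c * (INR k - (INR D + 1 - r)) - eps * (INR D + 1 - r) * q by lra.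
have cc : c <= 1 by case: (COS_bound (phi / 2)).
have h3 : c * (INR D - r) <= INR D by nra.
have h4 : eps * q * (INR D - r) <= eps * q * INR D by apply: Rmult_le_compat_l; nra.
suff : INR D + eps * q * INR D + eps * q < c * (INR k - 1) by lra.
apply: (Rmult_lt_reg_l K); first lra.
(* This sharpens [f2], because (1 + eps)(q + 1) - 2 (1 + eps q) = (1 - eps)(q - 1) > 0. *)
have h5 : INR D * K * (1 + eps * q) < (1 + eps) * (q * f).
  have : 0 < (1 - eps) * (q - 1) by nra.
  move=> /(Rmult_lt_compat_l _ _ _ DK); rewrite Rmult_0_r => h6.
  have : (1 + eps) * (INR D * K * (q + 1)) <= (1 + eps) * (2 * (q * f)) by apply: Rmult_le_compat_l; lra.
  lra.
lra.
Qed.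

(** * Partition functions with pendants *)

Section Pendants.

Variables (n k : nat) (adj : rel 'I_n) (w : 'I_n -> 'I_n -> cplx).
Hypothesis sg : simple_graph adj.

Implicit Types (S A B : {set 'I_n}) (phi psi : {ffun 'I_n -> 'I_k}) (l : 'I_k)
  (c : 'I_n -> seq (cplx * 'I_k)).

Definition factor (q : cplx * 'I_k) l : cplx := if q.2 == l then q.1 else C1.
Definition pend (s : seq (cplx * 'I_k)) l : cplx := \big[Cmul/C1]_(q <- s) factor q l.
(** Non-edges and bichromatic edges count as 1, so that products can range over all pairs in a
    vertex set and be split along partitions of it. *)
Definition edge phi (x y : 'I_n) : cplx :=
  if adj x y && (phi x == phi y) then wt w x y else C1.
Definition edges A phi : cplx :=
  \big[Cmul/C1]_(p : 'I_n * 'I_n | [&& (p.1 < p.2)%N, p.1 \in A & p.2 \in A]) edge phi p.1 p.2.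
Definition weight S c phi : cplx :=
  Cmul (edges S phi) (\big[Cmul/C1]_(v in S) pend (c v) (phi v)).
Definition agree S psi phi : bool := [forall v, (v \in S) || (phi v == psi v)].

(* The partition function of the graph induced on the free vertices [S], where a pair
   [(x, l)] in [c v] stands for a leaf of colour [l] hanging from [v] by an edge of weight [x].
   Vertices outside [S] are frozen at the colours of [psi]. *)
Definition Zpend S psi c : cplx := \big[Cadd/C0]_(phi | agree S psi phi) weight S c phi.
Definition Zpend_at S psi c (u : 'I_n) l : cplx :=
  \big[Cadd/C0]_(phi | agree S psi phi && (phi u == l)) weight S c phi.

Definition add_pend c (v : 'I_n) (x : cplx) l : 'I_n -> seq (cplx * 'I_k) :=
  fun y => if y == v then (x, l) :: c y else c y.
(** The leaves left behind when [u] is removed at colour [l]. The receiving vertices form a list so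
    that leaves can be recoloured one by one by induction. *)
Definition add_leaves (u : 'I_n) c (s : seq 'I_n) l : 'I_n -> seq (cplx * 'I_k) :=
  fun y => if y \in s then (wt w u y, l) :: c y else c y.
Definition nbrs S (u : 'I_n) : {set 'I_n} := [set v in S | adj u v].

Lemma adj_sym x y : adj x y = adj y x.
Proof. by case: sg. Qed.

Lemma adj_irr x : adj x x = false.
Proof. by case: sg. Qed.

Lemma wt_sym x y : wt w x y = wt w y x.
Proof. by rewrite /wt; case: ltngtP => // /val_inj ->. Qed.

Lemma edge_sym phi x y : edge phi x y = edge phi y x.
Proof. by rewrite /edge adj_sym eq_sym wt_sym. Qed.

Lemma edges_union A B phi : [disjoint A & B] ->
  edges (A :|: B) phi = Cmul (Cmul (edges A phi) (edges B phi))
    (\big[Cmul/C1]_(v in A) \big[Cmul/C1]_(x in B) edge phi v x).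
Proof.
move=> dAB; have nAB x : x \in A -> x \in B = false by move=> xA; apply: (disjointFr dAB).
rewrite pair_big /= /edges (bigID (fun p : 'I_n * 'I_n => p.1 \in A)) /=.
rewrite (bigID (fun p : 'I_n * 'I_n => p.2 \in A)) /=.
rewrite [X in Cmul _ X = _](bigID (fun p : 'I_n * 'I_n => p.2 \in A)) /=.
rewrite [X in _ = Cmul _ X](bigID (fun p : 'I_n * 'I_n => (p.1 < p.2)%N)) /=.
have comb e1 e2 e3 e4 f1 f2 f3 f4 : e1 = f1 -> e4 = f2 -> e2 = f3 -> e3 = f4 ->
    Cmul (Cmul e1 e2) (Cmul e3 e4) = Cmul (Cmul f1 f2) (Cmul f3 f4).
  move=> -> -> -> ->; rewrite -!CmulA; congr Cmul; rewrite !CmulA [RHS]CmulC.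
  by rewrite [RHS]CmulC -!CmulA [RHS]CmulC !CmulA.
apply: comb.
- apply: eq_bigl => -[x y] /=; rewrite !inE.
  by case: (x \in A); case: (y \in A); rewrite /= ?andbT ?andbF.
- apply: eq_bigl => -[x y] /=; rewrite !inE; have := nAB x; have := nAB y.
  case: (y \in A) => [/(_ isT) ->|_]; case: (x \in A) => [/(_ isT) ->|_];
    by rewrite /= ?andbT ?andbF.
- apply: eq_bigl => -[x y] /=; rewrite !inE; have := nAB x; have := nAB y.
  case: (y \in A) => [/(_ isT) ->|_]; case: (x \in A) => [/(_ isT) ->|_];
    by rewrite /= ?andbT ?andbF // andbC.
(* Cross pairs whose smaller vertex lies in [B] are matched with pairs in A x B by swapping the
   coordinates. *)
- rewrite (reindex_onto (fun p : 'I_n * 'I_n => (p.2, p.1)) (fun p => (p.2, p.1))) /=; last by case.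
  under [RHS]eq_bigr do rewrite edge_sym.
  apply: eq_bigl => -[x y] /=; rewrite !inE eqxx andbT.
  have := nAB x; have := nAB y.
  case: (boolP (x \in A)) => xA; last by rewrite /= ?andbF.
  move=> h1 h2; rewrite h2 //= !andbT.
  case: (boolP (y \in A)) => yA; first by rewrite h1 //= ?andbF.
  rewrite /= ?andbT andbC; case: (boolP (y \in B)) => //= yB.
  by case: ltngtP => // /val_inj yx; rewrite yx xA in yA.
Qed.

Lemma edges1 u phi : edges [set u] phi = C1.
Proof.
apply: big_pred0 => -[x y] /=; rewrite !inE; apply/negP => /and3P [h /eqP e1 /eqP e2].
by rewrite e1 e2 ltnn in h.
Qed.

Lemma eq_weight S c c' phi phi' :
  {in S, phi =1 phi'} -> {in S, c =1 c'} -> weight S c phi = weight S c' phi'.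
Proof.
move=> h hc; congr Cmul; last by apply: eq_bigr => v vS; rewrite h ?hc.
by apply: eq_bigr => p /and3P [_ h1 h2]; rewrite /edge !h.
Qed.

Lemma eq_Zpend S psi c c' : {in S, c =1 c'} -> Zpend S psi c = Zpend S psi c'.
Proof. by move=> h; apply: eq_bigr => phi _; apply: eq_weight. Qed.

Lemma Zpend_frozen S psi psi' c : Zpend S psi c = Zpend S psi' c.
Proof.
pose g psi phi : {ffun 'I_n -> 'I_k} := [ffun v => if v \in S then phi v else psi v].
have gK psi1 psi2 phi : agree S psi1 phi -> g psi1 (g psi2 phi) = phi.
  move=> /forallP h; apply/ffunP => v; rewrite !ffunE; case: ifP => [->//|vS].
  by have := h v; rewrite vS => /eqP.
have ag psi1 phi : agree S psi1 (g psi1 phi).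
  by apply/forallP => v; rewrite ffunE; case: (v \in S) => /=.
rewrite /Zpend (reindex_onto (g psi) (g psi')) => [|phi /gK //].
rewrite (eq_bigl (agree S psi')) => [|phi].
  by apply: eq_bigr => phi _; apply: eq_weight => // v vS; rewrite ffunE vS.
rewrite ag /=; apply/eqP/idP => [<- | /gK //]; exact: ag.
Qed.

Lemma Zpend_sum S psi c u : Zpend S psi c = \big[Cadd/C0]_l Zpend_at S psi c u l.
Proof. exact: (partition_big (fun phi : {ffun 'I_n -> 'I_k} => phi u) predT). Qed.

(** Once [u] has colour [l], its own pendants give a constant factor, and each edge from [u] to a
    free neighbour depends only on the colour of that neighbour, exactly as a pendant of colour [l]
    does. *)
Lemma Zpend_atE S psi c u l : u \in S ->
  Zpend_at S psi c u l =
  Cmul (pend (c u) l) (Zpend (S :\ u) psi (add_leaves u c (enum (nbrs S u)) l)).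
Proof.
move=> uS; pose psi' : {ffun 'I_n -> 'I_k} := [ffun v => if v == u then l else psi v].
rewrite (Zpend_frozen _ psi psi') [RHS]big_distrr /=.
apply: eq_big => [phi|phi /andP [_ /eqP hu]].
  apply/andP/forallP => [[/forallP h /eqP hu] v|h].
    by rewrite !inE ffunE; case: eqP => [->|_] /=; [rewrite hu | exact: h].
  split; last by have := h u; rewrite !inE ffunE eqxx.
  apply/forallP => v; have := h v; rewrite !inE ffunE.
  by case: eqP => [->|_] //=; rewrite uS.
have ES : S = (S :\ u) :|: [set u] by rewrite setUC setD1K.
have dS : [disjoint S :\ u & [set u]].
  by rewrite disjoint_sym disjoints1 !inE eqxx.
rewrite /weight {1}ES edges_union // edges1.
rewrite (bigD1 u uS) /= hu.
have -> : \big[Cmul/C1]_(v in S :\ u) pend (add_leaves u c (enum (nbrs S u)) l v) (phi v) =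
  Cmul (\big[Cmul/C1]_(v in S :\ u) \big[Cmul/C1]_(x in [set u]) edge phi v x)
       (\big[Cmul/C1]_(i in S | i != u) pend (c i) (phi i)).
  rewrite [X in _ = Cmul _ X](eq_bigl (mem (S :\ u))) => [|v]; last by rewrite !inE andbC.
  rewrite -big_split /=; apply: eq_bigr => v; rewrite !inE => /andP [vu vS].
  rewrite big_set1 /add_leaves mem_enum inE vS /= edge_sym /edge hu.
  case: (adj u v) => /=; last by rewrite Cmul1.
  by rewrite /pend big_cons.
set X := edges _ _; set Y := \big[_/_]_(_ in _) _; set T := \big[_/_]_(_ | _) _.
rewrite (CmulC X C1) Cmul1; move: (pend _ _) => q.
by rewrite !CmulA; congr Cmul; rewrite (CmulC q) -!CmulA; congr Cmul; rewrite CmulC.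
Qed.

Lemma Zpend_at_add S psi c v x l0 l : v \in S ->
  Zpend_at S psi (add_pend c v x l0) v l = Cmul (factor (x, l0) l) (Zpend_at S psi c v l).
Proof.
move=> vS; rewrite !Zpend_atE // CmulA; congr Cmul.
  by rewrite /add_pend eqxx /pend big_cons.
apply: eq_Zpend => y; rewrite !inE => /andP [yv _].
by rewrite /add_leaves /add_pend (negbTE yv).
Qed.

(** A pendant (x, i) at [v] rescales only the part in which [v] has colour i. The total therefore
    becomes T + (x - 1) a_i, and T cancels in the difference. *)
Lemma Zpend_add_sub S psi c v x l l' : v \in S ->
  Csub (Zpend S psi (add_pend c v x l)) (Zpend S psi (add_pend c v x l')) =
  Cmul (Csub x C1) (Csub (Zpend_at S psi c v l) (Zpend_at S psi c v l')).
Proof.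
move=> vS; pose T := \big[Cadd/C0]_i Zpend_at S psi c v i.
have h i : Zpend S psi (add_pend c v x i) = Cadd T (Cmul (Csub x C1) (Zpend_at S psi c v i)).
  rewrite (Zpend_sum S psi _ v); under eq_bigr do rewrite Zpend_at_add //.
  rewrite (bigD1 i) //= /T [in RHS](bigD1 i) //=.
  rewrite (eq_bigr (Zpend_at S psi c v)) => [|j ji]; last first.
    by rewrite /factor /= eq_sym (negbTE ji) Cmul1.
  by rewrite /factor eqxx; apply: Ceq; rewrite /=; ring.
by rewrite !h; apply: Ceq; rewrite /=; ring.
Qed.

Lemma Zpend0 psi c : Zpend set0 psi c = C1.
Proof.
rewrite /Zpend (big_pred1 psi) => [|phi].
  rewrite /weight big_set0 CmulC Cmul1; apply: big_pred0 => p.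
  by rewrite !inE !andbF.
apply/forallP/eqP => [h|-> v]; last by rewrite eqxx orbT.
by apply/ffunP => v; have := h v; rewrite inE => /eqP.
Qed.

Lemma card_nbrsD1 S u v : u \in S ->
  #|nbrs S v| = (#|nbrs (S :\ u) v| + adj u v)%N.
Proof.
move=> uS; rewrite (cardsD1 u) !inE uS /= adj_sym addnC; congr addn.
by congr #|pred_of_set _|; apply/setP => y; rewrite !inE andbA.
Qed.

End Pendants.

(** * The induction *)

Lemma near_polar r t r' t' z : 0 < r -> 0 < r' ->
  near (Rabs t + Rabs t') (r' / r) (Cmul (polar r t) z) (Cmul (polar r' t') z).
Proof.
move=> r0 r'0; exists (r' / r), (t' - t); split.
  by split; [exact: Rdiv_lt_0_compat | lra].
split.
  by rewrite Rplus_comm -(Rabs_Ropp t); exact: Rabs_triang.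
by rewrite CmulA polarM; congr (Cmul (polar _ _) z); [field; lra | ring].
Qed.

Section Stability.

Variables (Delta n k : nat) (adj : rel 'I_n) (w : 'I_n -> 'I_n -> cplx) (eps K theta : R).
Hypotheses (sg : simple_graph adj) (Deltak : (Delta < k)%N)
  (heps : 0 < eps < 1) (hK : 0 < K < 1) (thetaE : theta = asin K) (theta0 : 0 < theta)
  (theta3 : (INR Delta - 1 + eps) * theta <= PI / 3) (theta2 : INR Delta * theta <= PI / 2).

(** The opening of the cone of non-bad colours: theta for each free neighbour and eps * theta for
    each of the remaining Delta - d places. *)
Definition phi_d (d : nat) : R := (INR d + (INR Delta - INR d) * eps) * theta.

Hypotheses
  (den0 : forall d, (d <= Delta)%N -> 0 < denom Delta d k eps K theta)
  (cond1 : forall d, (d <= Delta - 2)%N ->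
     (1 + eps) ^ 2 * (1 + K) ^ d <= K * denom Delta d k eps K theta)
  (cond2 : forall d, (d <= Delta - 1)%N ->
     (1 + eps) * (1 + K) ^ d * fdK d K (phi_d d) <= K * denom Delta d k eps K theta).

(** The polar form makes the arguments of products of weights directly additive. *)
Definition okw (x : cplx) : Prop :=
  Cnorm x <= eps \/
  (eps < Cnorm x <= 1 /\ exists2 t, Rabs t <= eps * theta & x = polar (Cnorm x) t).

Hypothesis wok : forall u v, adj u v -> okw (wt w u v).

Implicit Types (S : {set 'I_n}) (psi : {ffun 'I_n -> 'I_k}) (l : 'I_k)
  (c : 'I_n -> seq (cplx * 'I_k)) (s : seq (cplx * 'I_k)).

Definition ok_pend s : Prop := List.Forall (fun q : cplx * 'I_k => okw q.1) s.
Definition is_bad l (q : cplx * 'I_k) : bool := Rle_dec (Cnorm q.1) eps && (q.2 == l).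
Definition has_colour l (q : cplx * 'I_k) : bool := q.2 == l.
Definition good s l : bool := l \notin map snd s.

Lemma okw_norm_le1 x : okw x -> Cnorm x <= 1.
Proof. by case=> [|[]]; lra. Qed.

(** For a small weight this is the triangle inequality. Otherwise x and 1 have modulus at most 1 and
    differ in angle by at most pi / 3, so their distance is at most 1. *)
Lemma okw_sub1 x : (1 <= Delta)%N -> okw x -> Cnorm (Csub x C1) <= 1 + eps.
Proof.
move=> D1 [h|[hx [t ht e]]].
  by have := Cnorm_sub x C1; rewrite Cnorm1; lra.
have rD : 1 <= INR Delta by have -> : 1 = INR 1 by []; apply: le_INR; apply/leP.
have et : eps * theta <= PI / 3.
  by apply: Rle_trans theta3; apply: Rmult_le_compat_r; lra.
apply: Rle_trans (_ : 1 <= _); last lra.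
have nr : near (eps * theta) (Cnorm x) C1 x.
  exists (Cnorm x), t; split; first lra; split=> //.
  by rewrite CmulC Cmul1.
rewrite Cnorm_subC; apply: (near_chord_le_max et nr); rewrite ?Cnorm1; lra.
Qed.

Lemma pend_good s l : good s l -> pend s l = C1.
Proof.
rewrite /good /pend; elim: s => [|q s IH]; first by rewrite big_nil.
rewrite /= inE negb_or big_cons => /andP [h1 h2].
by rewrite IH // /factor eq_sym (negbTE h1) Cmul1.
Qed.

Lemma pend_norm s l : ok_pend s -> Cnorm (pend s l) <= eps ^ count (is_bad l) s.
Proof.
rewrite /pend; elim=> [|q {}s hq _ IH]; first by rewrite big_nil Cnorm1 /=; lra.
rewrite big_cons CnormM /=; have n0 := Cnorm_ge0 (\big[Cmul/C1]_(j <- s) factor j l).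
have e0 : 0 <= eps ^ count (is_bad l) s by apply: pow_le; lra.
have f0 := Cnorm_ge0 (factor q l).
rewrite pow_add; apply: Rmult_le_compat => //.
rewrite /factor /is_bad; case: (q.2 == l); last by rewrite Cnorm1 andbF /=; lra.
rewrite andbT; case: Rle_dec => h /=; [lra | exact: okw_norm_le1].
Qed.

Lemma pend_polar s l : ok_pend s -> ~~ has (is_bad l) s ->
  exists r t, 0 < r /\ Rabs t <= INR (count (has_colour l) s) * (eps * theta) /\
    pend s l = polar r t.
Proof.
rewrite /pend; elim=> [_|q {}s hq _ IH].
  by exists 1, 0; rewrite big_nil polar10 Rabs_R0 /=; split; [lra | split; [lra|]].
rewrite /= negb_or => /andP [h1 /IH [r [t [r0 [ht e]]]]].
rewrite big_cons e -plusE plus_INR Rmult_plus_distr_r {1}/has_colour /factor.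
move: h1; rewrite /is_bad; case: (q.2 == l); last first.
  by move=> _; rewrite Cmul1; exists r, t; split=> //; split=> //=; lra.
rewrite andbT; case: Rle_dec => //= hn _.
case: hq => [|[hx [t1 ht1 ->]]]; first by lra.
exists (Cnorm q.1 * r), (t1 + t); split; first by nra.
split; last by rewrite polarM.
by have := Rabs_triang t1 t; lra.
Qed.

(** No pendant has both colours. Hence the arguments of the two pendant factors together use each
    pendant at most once, and the angle between them is bounded by [size s] times eps * theta rather
    than twice that. *)
Lemma count_colour2 s l l' : l != l' ->
  (count (has_colour l) s + count (has_colour l') s <= size s)%N.
Proof.
move=> ll'; rewrite -count_predUI [X in (_ + X)%N](_ : _ = 0%N).
  by rewrite addn0; exact: count_size.
by rewrite -(count_pred0 s); apply: eq_count => q /=; rewrite /has_colour; case: eqP => // ->; apply/negbTE.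
Qed.

Lemma pend_near s l l' z : ok_pend s -> ~~ has (is_bad l) s -> ~~ has (is_bad l') s ->
  exists rho, near (INR (size s) * (eps * theta)) rho (Cmul (pend s l) z) (Cmul (pend s l') z).
Proof.
move=> ok h h'; have et : 0 < eps * theta by nra.
case: (eqVneq l l') => [<-|ll'].
  exists 1; apply: near_weak (near_refl _); last lra.
  by apply: Rmult_le_pos; [exact: pos_INR | lra].
have [r [t [r0 [ht ->]]]] := pend_polar ok h.
have [r' [t' [r'0 [ht' ->]]]] := pend_polar ok h'.
exists (r' / r); apply: near_weak (near_polar t t' z r0 r'0); last lra.
have /leP/le_INR := count_colour2 s ll'; rewrite -plusE plus_INR => hc.
by have := Rmult_le_compat_r _ _ _ (Rlt_le _ _ et) hc; lra.
Qed.

(** Free neighbours and pendants together count as the degree. Removing a free vertex turns one free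
    neighbour of each of its neighbours into one pendant, so the bound is inherited. *)
Definition valid S c : Prop :=
  forall v, v \in S -> (#|nbrs adj S v| + size (c v) <= Delta)%N /\ ok_pend (c v).

(** The induction hypothesis: the analogues of (A') and (B') for pendants. The strict inequality
    reserves a place at [v] for the extra pendant. *)
Definition stable S : Prop := forall psi c, valid S c ->
  Zpend adj w S psi c <> C0 /\
  forall v x l l', v \in S -> okw x -> (#|nbrs adj S v| + size (c v) < Delta)%N ->
    near theta (1 + K) (Zpend adj w S psi (add_pend c v x l))
                       (Zpend adj w S psi (add_pend c v x l')).

(** A hybrid argument: the leaves change from [l] to [l'] one at a time. Each change costs one
    application of stability, and a recoloured leaf is absorbed into [c] before the next one is
    changed. *)
Lemma add_leaves_near S psi u (s : seq 'I_n) c l l' : stable S ->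
  uniq s -> {subset s <= S} -> (forall v, v \in s -> adj u v) ->
  (forall v, v \in S -> (#|nbrs adj S v| + size (c v) + (v \in s) <= Delta)%N /\ ok_pend (c v)) ->
  near (INR (size s) * theta) ((1 + K) ^ size s)
    (Zpend adj w S psi (add_leaves w u c s l)) (Zpend adj w S psi (add_leaves w u c s l')).
Proof.
move=> stS; elim: s c => [|v s IH] c.
  by move=> _ _ _ _; rewrite /= Rmult_0_l; apply: near_refl.
rewrite cons_uniq -[size (v :: s)]/((size s).+1) S_INR -tech_pow_Rmult.
move=> /andP [vs us] sub hadj hv.
have vS : v \in S by apply: sub; rewrite mem_head.
have ov := wok (hadj v (mem_head _ _)).
have -> : Zpend adj w S psi (add_leaves w u c (v :: s) l) =
          Zpend adj w S psi (add_pend (add_leaves w u c s l) v (wt w u v) l).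
  apply: eq_Zpend => y _; rewrite /add_pend /add_leaves inE.
  by case: eqP => //= ->; rewrite (negbTE vs).
have -> : Zpend adj w S psi (add_leaves w u c (v :: s) l') =
          Zpend adj w S psi (add_leaves w u (add_pend c v (wt w u v) l') s l').
  apply: eq_Zpend => y _; rewrite /add_pend /add_leaves inE.
  by case: eqP => //= ->; rewrite (negbTE vs).
have e : Zpend adj w S psi (add_pend (add_leaves w u c s l) v (wt w u v) l') =
         Zpend adj w S psi (add_leaves w u (add_pend c v (wt w u v) l') s l).
  apply: eq_Zpend => y _; rewrite /add_pend /add_leaves.
  by case: eqP => //= ->; rewrite (negbTE vs).
have -> : (INR (size s) + 1) * theta = theta + INR (size s) * theta by ring.
apply: near_trans (_ : near _ _ _ (Zpend adj w S psi (add_pend (add_leaves w u c s l) v (wt w u v) l'))) _.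
  have val : valid S (add_leaves w u c s l).
    move=> y yS; have [h1 h2] := hv y yS; rewrite /add_leaves; case: ifP => ys.
      split; last by constructor=> //; apply: wok; apply: hadj; rewrite inE ys orbT.
      by move: h1; rewrite inE ys orbT /= addn1 addnS.
    by split=> //; apply: leq_trans h1; apply: leq_addr.
  have [_ st] := stS psi _ val; apply: st => //.
  have [h1 _] := hv v vS; move: h1; rewrite mem_head addn1 /add_leaves.
  by rewrite (negbTE vs).
rewrite e; apply: IH => //.
- by move=> y ys; apply: sub; rewrite inE ys orbT.
- by move=> y ys; apply: hadj; rewrite inE ys orbT.
move=> y yS; have [h1 h2] := hv y yS; rewrite /add_pend; case: eqP h1 h2 => [->|/eqP yv] h1 h2.
  split; last by constructor.
  by move: h1; rewrite mem_head (negbTE vs) /= addn0 addn1 addnS.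
by split=> //; move: h1; rewrite inE (negbTE yv).
Qed.

Lemma valid_add_leaves S u c l : u \in S -> valid S c ->
  valid (S :\ u) (add_leaves w u c (enum (nbrs adj S u)) l).
Proof.
move=> uS val v; rewrite !inE => /andP [vu vS].
have [h1 h2] := val v vS; rewrite /add_leaves mem_enum inE vS /=.
move: h1; rewrite (card_nbrsD1 sg v uS); case: (boolP (adj u v)) => a; rewrite ?addn0 // => h1.
split; last by constructor=> //; apply: wok.
by move: h1; rewrite addn1 /= addnS addSn.
Qed.

(** The analogue of (C'). By [Zpend_atE], comparing two colours of [u] means recolouring d leaves in
    the smaller instance, which accounts for d * theta and (1 + K)^d, and comparing the factors of
    the pendants at [u] itself. These contribute eps * theta each to the angle, and a factor eps for
    each bad pendant; for a good colour the factor is 1. *)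
Lemma Zpend_at_ratio S psi c u : u \in S -> valid S c -> stable (S :\ u) ->
  let d := #|nbrs adj S u| in let a := Zpend_at adj w S psi c u in
  [/\ forall l, ~~ has (is_bad l) (c u) -> a l <> C0,
      forall l l', ~~ has (is_bad l) (c u) -> ~~ has (is_bad l') (c u) ->
        exists rho, near ((INR d + INR (size (c u)) * eps) * theta) rho (a l) (a l') &
      forall l j, good (c u) j ->
        Cnorm (a l) <= eps ^ count (is_bad l) (c u) * (1 + K) ^ d * Cnorm (a j)].
Proof.
move=> uS val st d a; have [hu oku] := val u uS.
have aE l := Zpend_atE w sg psi c l uS.
have nr l l' : near (INR d * theta) ((1 + K) ^ d)
    (Zpend adj w (S :\ u) psi (add_leaves w u c (enum (nbrs adj S u)) l))
    (Zpend adj w (S :\ u) psi (add_leaves w u c (enum (nbrs adj S u)) l')).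
  have -> : d = size (enum (nbrs adj S u)) by rewrite -cardE.
  apply: add_leaves_near => //; first exact: enum_uniq.
  - move=> v; rewrite mem_enum !inE => /andP [vS a']; rewrite vS andbT.
    by apply/eqP => vu; rewrite vu (adj_irr sg) in a'.
  - by move=> v; rewrite mem_enum inE => /andP [].
  move=> v; rewrite !inE => /andP [vu vS]; have [h1 h2] := val v vS; split=> //.
  rewrite mem_enum inE vS /=; move: h1; rewrite (card_nbrsD1 sg v uS).
  by rewrite addnAC.
split.
- move=> l hl; rewrite /a aE; apply: Cmul_neq0.
    have [r [t [r0 [_ ->]]]] := pend_polar oku hl.
    by apply: Cnorm_gt0_neq0; rewrite Cnorm_polar //; lra.
  by have [] := st psi _ (valid_add_leaves l uS val).
- move=> l l' hl hl'; rewrite /a !aE.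
  have [rho h1] := pend_near (Zpend adj w (S :\ u) psi (add_leaves w u c (enum (nbrs adj S u)) l)) oku hl hl'.
  have h2 := near_mull (pend (c u) l') (nr l l').
  by have := near_trans h1 h2; eexists; apply: near_weak H; [lra | exact: Rle_refl].
move=> l j gj; rewrite /a !aE (pend_good gj) Cmul1 CnormM.
rewrite Rmult_assoc; apply: Rmult_le_compat; try exact: Cnorm_ge0.
  exact: pend_norm.
exact: near_norm (nr j l).
Qed.

Lemma card_good s : (k - size s <= #|good s|)%N.
Proof.
rewrite leq_subLR; apply: leq_trans (_ : #|'I_k| <= _)%N; first by rewrite card_ord.
rewrite -(cardC (mem (map snd s))); apply: leq_add; last by apply: eq_leq; apply: eq_card.
by apply: leq_trans (card_size _) _; rewrite size_map.
Qed.

Lemma has_bad_mem s l : has (is_bad l) s -> l \in map snd s.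
Proof.
elim: s => //= q s IH /orP [/andP [_ /eqP <-]|/IH h]; first exact: mem_head.
by rewrite inE h orbT.
Qed.

Lemma card_bad s : (#|[pred l | has (is_bad l) s]| <= size s)%N.
Proof.
apply: leq_trans (_ : #|map snd s| <= _)%N; last by rewrite -(size_map snd); exact: card_size.
by apply: subset_leq_card; apply/subsetP => l; rewrite inE => /has_bad_mem.
Qed.

(** With j a good colour minimising |a_j|, at least k - b good colours each contribute the cosine
    times |a_j| along the bisector of the cone, while at most b bad colours each have modulus at
    most eps (1 + K)^d |a_j|. The balance is [denom] times |a_j|. *)
Lemma Zpend_ge S psi c u : u \in S -> valid S c -> stable (S :\ u) ->
  exists2 j, good (c u) j &
    0 < Cnorm (Zpend_at adj w S psi c u j) /\
    denom Delta #|nbrs adj S u| k eps K theta * Cnorm (Zpend_at adj w S psi c u j)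
      <= Cnorm (Zpend adj w S psi c).
Proof.
move=> uS val st; have [hu oku] := val u uS.
have [a0 anear anorm] := Zpend_at_ratio psi uS val st.
set d := #|nbrs adj S u| in hu anear anorm *; set a := Zpend_at adj w S psi c u in a0 anear anorm *.
have good_nb j : good (c u) j -> ~~ has (is_bad j) (c u) by apply: contra => /has_bad_mem.
have pD : (size (c u) <= Delta)%N by apply: leq_trans hu; apply: leq_addl.
have : (0 < #|good (c u)|)%N.
  by apply: leq_trans (card_good _); rewrite subn_gt0; apply: leq_ltn_trans Deltak.
case/card_gt0P => j0 gj0.
have [j] : exists2 j, good (c u) j & forall i, good (c u) i -> Cnorm (a j) <= Cnorm (a i).
  case E : (enum (good (c u))) => [|x s']; first by move: gj0; rewrite -mem_enum E.
  have [i hi him] := ex_argmax (fun i => - Cnorm (a i)) x s'.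
  exists i => [|i' gi]; first by rewrite -E mem_enum in hi.
  have : i' \in x :: s' by rewrite -E mem_enum.
  by move/him; lra.
move=> gj jmin; exists j => //; have aj0 := Cnorm_gt0 (a0 j (good_nb j gj)); split=> //.
rewrite (Zpend_sum adj w S psi c u) -/a.
have rd : INR d + INR (size (c u)) <= INR Delta by rewrite -plus_INR; apply: le_INR; apply/leP.
have d0 := pos_INR d; have p0 := pos_INR (size (c u)).
have q1 : 1 <= (1 + K) ^ d by apply: pow_R1_Rle; lra.
set al := (INR d + INR (size (c u)) * eps) * theta in anear *.
set b := INR Delta - INR d.
have ab : 0 <= al <= (INR d + b * eps) * theta.
  split; rewrite /al; first by apply: Rmult_le_pos; nra.
  by apply: Rmult_le_compat_r; rewrite /b; nra.
have b2 : (INR d + b * eps) * theta <= PI / 2.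
  apply: Rle_trans theta2; apply: Rmult_le_compat_r; rewrite /b; nra.
have badn i : has (is_bad i) (c u) -> Cnorm (a i) <= eps * (1 + K) ^ d * Cnorm (a j).
  move=> bi; apply: Rle_trans (anorm i j gj) _.
  apply: Rmult_le_compat_r; first lra; apply: Rmult_le_compat_r; first lra.
  move: bi; rewrite has_count; case: (count _ _) => // m _ /=.
  have [m0 m1] : 0 <= eps ^ m <= 1.
    by split; [apply: pow_le; lra | rewrite -(pow1 m); apply: pow_incr; lra].
  by nra.
apply: Rle_trans (@cone_sum_ge _ (good (c u)) [pred l | has (is_bad l) (c u)] a al _ _
  (conj (proj1 ab) (Rle_trans _ _ _ (proj2 ab) b2)) good_nb a0 anear jmin badn).
(* The two counts and the angle are relaxed from the number of pendants at [u] to b = Delta - d,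
   which is at least as large. *)
have cg : INR k - b <= INR #|good (c u)|.
  have /leP/le_INR := card_good (c u); rewrite -minusE minus_INR; last first.
    by apply/leP; apply: ltnW; apply: leq_ltn_trans Deltak.
  by rewrite /b; lra.
have cb : INR #|[pred l | has (is_bad l) (c u)]| <= b.
  by have /leP/le_INR := card_bad (c u); rewrite /b; lra.
have cc : cos ((INR d + b * eps) * theta / 2) <= cos (al / 2) by apply: cos_decr_1; lra.
have c0 : 0 <= cos ((INR d + b * eps) * theta / 2) by apply: cos_ge_0; lra.
have kD : INR Delta <= INR k by apply: le_INR; apply/leP; apply: ltnW.
rewrite /denom -/b.
set C := cos (_ * _ / 2) in cc c0 *; set Q := (1 + K) ^ d in q1 *; set M := Cnorm (a j) in aj0 *.
have h1 : (INR k - b) * (C * M) <= INR #|good (c u)| * (cos (al / 2) * M).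
  apply: Rmult_le_compat => //; first by rewrite /b; lra.
    by nra.
  by apply: Rmult_le_compat_r; lra.
have h2 : INR #|[pred l | has (is_bad l) (c u)]| * (eps * Q * M) <= b * (eps * Q * M).
  apply: Rmult_le_compat_r => //; apply: Rmult_le_pos; last lra.
  by apply: Rmult_le_pos; lra.
apply: Rle_trans (Rplus_le_compat _ _ _ _ h1 (Ropp_le_contravar _ _ h2)).
by rewrite /denom -/C -/Q; lra.
Qed.

Lemma phi_d_bounds d : (d < Delta)%N -> 0 < phi_d d <= PI / 3.
Proof.
move=> dD; have r1 : INR d + 1 <= INR Delta by rewrite -S_INR; apply: le_INR; apply/leP.
have d0 := pos_INR d; rewrite /phi_d; split; first by apply: Rmult_lt_0_compat; nra.
by apply: Rle_trans theta3; apply: Rmult_le_compat_r; nra.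
Qed.

(** By [near_of_sub] and [Zpend_add_sub] it suffices that |x - 1| |a_l' - a_l| <= K |Z|, where |Z|
    is bounded below by [Zpend_ge] and |x - 1| by 1 + eps. The numerical condition to use depends on
    whether [v] already carries a pendant. *)
Lemma Zpend_add_near S psi c v x l l' : v \in S -> valid S c -> okw x ->
  (#|nbrs adj S v| + size (c v) < Delta)%N -> stable (S :\ v) ->
  near theta (1 + K) (Zpend adj w S psi (add_pend c v x l))
                     (Zpend adj w S psi (add_pend c v x l')).
Proof.
move=> vS val okx hsz st.
have val' : valid S (add_pend c v x l).
  move=> y yS; have [h1 h2] := val y yS; rewrite /add_pend; case: eqP => [yv|_]; last by [].
  by split; [rewrite yv /= addnS | constructor].
have [a0 anear anorm] := Zpend_at_ratio psi vS val st.
have [j gj [aj0 hge]] := Zpend_ge psi vS val' st.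
have okv := proj2 (val v vS).
(* The colour j is good for the enlarged list, so it differs from [l]: the new pendant leaves a_j
   unchanged, and j is good for [c v] too. *)
move: gj aj0 hge; rewrite Zpend_at_add // {1}/add_pend eqxx /good /= inE negb_or => /andP [jl gj].
rewrite /factor /= eq_sym (negbTE jl) Cmul1.
set d := #|nbrs adj S v| in hsz anear anorm *; set a := Zpend_at adj w S psi c v in a0 anear anorm *.
set M := Cnorm (a j); set Q := (1 + K) ^ d in anorm *; set N := denom _ _ _ _ _ _ => M0 hge.
have dD : (d < Delta)%N by apply: leq_ltn_trans hsz; apply: leq_addr.
have N0 : 0 < N by apply: den0; apply: ltnW.
have Z0 : 0 < Cnorm (Zpend adj w S psi (add_pend c v x l)) by nra.
rewrite thetaE; apply: near_of_sub => //; first exact: Cnorm_gt0_neq0.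
rewrite (Zpend_add_sub w sg) // CnormM -/a.
apply: Rle_trans (_ : K * (N * M) <= _); last by apply: Rmult_le_compat_l; lra.
have x1 : Cnorm (Csub x C1) <= 1 + eps by apply: okw_sub1 => //; apply: leq_ltn_trans dD.
have q1 : 1 <= Q by apply: pow_R1_Rle; lra.
have [ph0 ph3] := phi_d_bounds dD.
have sle : (INR d + INR (size (c v)) * eps) * theta <= phi_d d.
  apply: Rmult_le_compat_r; first lra.
  have : INR d + INR (size (c v)) <= INR Delta.
    by rewrite -plus_INR; apply: le_INR; apply/leP; apply: ltnW.
  nra.
have QM : M <= Q * M by nra.
have pi := PI_RGT_0.
have fin y z : Cnorm (Csub (a l') (a l)) <= y -> (1 + eps) * y <= z ->
    Cnorm (Csub x C1) * Cnorm (Csub (a l') (a l)) <= z.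
  move=> h1 h2; apply: Rle_trans h2; apply: Rmult_le_compat => //; exact: Cnorm_ge0.
have anormb i : has (is_bad i) (c v) -> Cnorm (a i) <= eps * (Q * M).
  move=> bi; apply: Rle_trans (anorm i j gj) _; rewrite -/M Rmult_assoc.
  apply: Rmult_le_compat_r; first lra.
  move: bi; rewrite has_count; case: (count _ _) => // m _ /=.
  have [m0 m1] : 0 <= eps ^ m <= 1.
    by split; [apply: pow_le; lra | rewrite -(pow1 m); apply: pow_incr; lra].
  by nra.
have anorm1 i : Cnorm (a i) <= Q * M.
  apply: Rle_trans (anorm i j gj) _; rewrite -/M Rmult_assoc -[X in _ <= X]Rmult_1_l.
  apply: Rmult_le_compat_r; first lra.
  by rewrite -(pow1 (count (is_bad i) (c v))); apply: pow_incr; lra.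
(* Without pendants every colour is good, so the ratios of |a_l| and |a_l'| are bounded both ways
   and the chord estimate by [fdK] applies. *)
case: (posnP (size (c v))) => [/size0nil c0|cpos].
  have gd i : good (c v) i by rewrite /good c0.
  have [rho nr] := anear l' l (ltac:(by rewrite c0)) (ltac:(by rewrite c0)).
  have anormg i i' : Cnorm (a i) <= Q * Cnorm (a i').
    by have := anorm i i' (gd i'); rewrite c0 /= Rmult_1_l.
  apply: (fin (fdK d K (phi_d d) * (Q * M))).
    by apply: (near_chord_le_fdK (proj1 hK) _ (near_weak sle (Rle_refl rho) nr)); try lra.
  have /cond2 : (d <= Delta - 1)%N by rewrite subn1 -ltnS prednK //; apply: leq_ltn_trans dD.
  move=> /(Rmult_le_compat_r M _ _ (Rlt_le _ _ M0)); rewrite -/N -/Q; lra.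
(* An existing pendant and the place for the new one leave d <= Delta - 2. If one of the two colours
   is bad, its term has modulus at most eps Q M and the triangle inequality suffices; if neither is,
   the angle is at most pi / 3 and the chord is at most Q M. *)
apply: (fin ((1 + eps) * (Q * M))); last first.
  have /cond1 : (d <= Delta - 2)%N.
    rewrite leq_subRL; last by apply: leq_trans hsz; rewrite ltnS; apply: leq_trans cpos (leq_addl _ _).
    by rewrite add2n; apply: leq_ltn_trans hsz; rewrite -addn1 leq_add2l.
  move=> /(Rmult_le_compat_r M _ _ (Rlt_le _ _ M0)); rewrite -/N -/Q /=; lra.
case: (boolP (has (is_bad l') (c v))) => [/anormb bl'|nl'].
  by apply: Rle_trans (Cnorm_sub _ _) _; have := anorm1 l; lra.
case: (boolP (has (is_bad l) (c v))) => [/anormb bl|nl].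
  by apply: Rle_trans (Cnorm_sub _ _) _; have := anorm1 l'; lra.
have [rho nr] := anear l' l nl' nl.
apply: Rle_trans (_ : Q * M <= _); last by nra.
by apply: (near_chord_le_max (Rle_trans _ _ _ sle ph3) nr).
Qed.

Lemma all_stable S : stable S.
Proof.
have [m] := ubnP #|S|; elim: m S => // m IH S hS psi c val.
have st u : u \in S -> stable (S :\ u).
  by move=> uS; apply: IH; move: hS; rewrite (cardsD1 u) uS.
split; last by move=> v x l l' vS okx hsz; apply: Zpend_add_near => //; exact: st.
case: (set_0Vmem S) => [->|[u uS]].
  by rewrite Zpend0 => /(f_equal re) /=; lra.
have [j gj [aj0 hge]] := Zpend_ge psi uS val (st u uS).
apply: Cnorm_gt0_neq0; apply: Rlt_le_trans hge; apply: Rmult_lt_0_compat => //.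
apply: den0; have [h _] := val u uS; apply: leq_trans h; exact: leq_addr.
Qed.

End Stability.

(** * Fixed vertices as pendants *)

Section FixedVertices.

Variables (n k : nat) (adj : rel 'I_n) (w : 'I_n -> 'I_n -> cplx) (c0 : 'I_k).
Hypothesis sg : simple_graph adj.
Implicit Types (W : seq 'I_n) (L : seq 'I_k) (phi psi : {ffun 'I_n -> 'I_k}).

Definition frozen W L : {ffun 'I_n -> 'I_k} := [ffun x => nth c0 L (index x W)].
Definition free_set W : {set 'I_n} := [set v | v \notin W].
Definition fixed_pend W psi (v : 'I_n) : seq (cplx * 'I_k) :=
  [seq (wt w v x, psi x) | x <- W & adj v x].

(** The constraint in [Zr] uses the value of the colouring itself as default, whereas [frozen] uses
    [c0]. Equal lengths keep every index in range, so the defaults agree. *)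
Lemma Zr_condE W L phi : uniq W -> size L = size W ->
  [forall i : 'I_(size W), phi (tnth (in_tuple W) i) == nth (phi (tnth (in_tuple W) i)) L i]
  = agree (free_set W) (frozen W L) phi.
Proof.
move=> uW sL; apply/forallP/forallP => [h v|h i].
  rewrite inE ffunE; case: (boolP (v \in W)) => //= vW.
  have iW : (index v W < size W)%N by rewrite index_mem.
  have := h (Ordinal iW); rewrite (tnth_nth v) /= nth_index //.
  by rewrite (set_nth_default c0) // sL.
set v := tnth _ i; have vE : v = nth v W i by rewrite {1}/v (tnth_nth v).
have vW : v \in W by rewrite vE mem_nth.
have := h v; rewrite inE vW /= ffunE => /eqP ->.
by rewrite {1}vE index_uniq // (set_nth_default c0) // sL.
Qed.

(** The edges split into those between free vertices, those inside [W], of which there are none, and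
    those across, which are the pendants. *)
Lemma Zr_termE W psi phi : uniq W -> (forall x y, x \in W -> y \in W -> adj x y = false) ->
  agree (free_set W) psi phi ->
  \big[Cmul/C1]_(p : 'I_n * 'I_n | [&& (p.1 < p.2)%N, adj p.1 p.2 & phi p.1 == phi p.2]) w p.1 p.2
  = weight adj w (free_set W) (fixed_pend W psi) phi.
Proof.
move=> uW ind /forallP ag.
have -> : \big[Cmul/C1]_(p : 'I_n * 'I_n | [&& (p.1 < p.2)%N, adj p.1 p.2 & phi p.1 == phi p.2])
   w p.1 p.2 = edges adj w setT phi.
  rewrite /edges big_mkcondr; apply: eq_big => [p|p lt]; first by rewrite !inE !andbT.
  by rewrite /edge /wt lt.
have -> : setT = free_set W :|: [set x in W].
  by apply/setP => x; rewrite !inE orNb.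
rewrite edges_union //; last first.
  by rewrite -setI_eq0; apply/eqP/setP => x; rewrite !inE andNb.
have -> : edges adj w [set x in W] phi = C1.
  apply: big1 => p /and3P [_]; rewrite !inE => h1 h2.
  by rewrite /edge ind.
rewrite (CmulC _ C1) Cmul1; congr Cmul; apply: eq_bigr => v vS.
rewrite /pend big_map big_filter [RHS]big_mkcond (big_uniq _ uW) /=.
apply: eq_big => [x|x]; rewrite inE // => xW.
have /eqP phix : phi x == psi x by have := ag x; rewrite inE xW.
by rewrite /edge /factor phix /= eq_sym; case: (adj v x).
Qed.

Lemma Zr_Zpend W L : uniq W -> (forall x y, x \in W -> y \in W -> adj x y = false) ->
  size L = size W ->
  Zr adj w W L = Zpend adj w (free_set W) (frozen W L) (fixed_pend W (frozen W L)).
Proof.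
move=> uW ind sL; apply: eq_big => [phi|phi]; rewrite Zr_condE // => ag.
exact: Zr_termE.
Qed.

(** Since [u] may be adjacent to [W], it is kept among the free vertices and its colour is imposed
    through [Zpend_at]. *)
Lemma Zr_rcons W L u l : uniq (rcons W u) ->
  (forall x y, x \in W -> y \in W -> adj x y = false) -> size L = size W ->
  Zr adj w (rcons W u) (rcons L l) =
  Zpend_at adj w (free_set W) (frozen W L) (fixed_pend W (frozen W L)) u l.
Proof.
move=> uWu ind sL; have := uWu; rewrite rcons_uniq => /andP [uW' uW].
have cond phi : agree (free_set (rcons W u)) (frozen (rcons W u) (rcons L l)) phi =
    agree (free_set W) (frozen W L) phi && (phi u == l).
  have fu : frozen (rcons W u) (rcons L l) u = l.
    by rewrite ffunE -(cats1 W) index_cat (negbTE uW') /= eqxx addn0 nth_rcons sL ltnn eqxx.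
  have fx x : x \in W -> frozen (rcons W u) (rcons L l) x = frozen W L x.
    by move=> xW; rewrite !ffunE -(cats1 W) index_cat xW nth_rcons sL index_mem xW.
  apply/forallP/andP => [h|[/forallP h /eqP hu] v].
    split; last by have := h u; rewrite inE mem_rcons mem_head /= fu.
    apply/forallP => v; rewrite inE; case: (boolP (v \in W)) => //= vW.
    by have := h v; rewrite inE mem_rcons inE vW orbT /= fx.
  rewrite inE mem_rcons inE; case: eqP => [->|_] /=; first by rewrite fu hu.
  by have := h v; rewrite inE; case: (boolP (v \in W)) => //= vW; rewrite fx.
apply: eq_big => [phi|phi]; rewrite Zr_condE ?size_rcons ?sL // cond // => /andP [ag _].
exact: Zr_termE.
Qed.

Lemma size_fixed_pend W psi v : uniq W ->
  (#|nbrs adj (free_set W) v| + size (fixed_pend W psi v) = deg adj v)%N.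
Proof.
move=> uW; rewrite /deg -[RHS](cardsID (free_set W)) size_map; congr addn.
  by apply: eq_card => x; rewrite !inE andbC.
rewrite -(card_uniqP (filter_uniq (adj v) uW)); apply: eq_card => x.
by rewrite !inE mem_filter negbK andbC.
Qed.

Lemma nbrs_free W u : #|nbrs adj (free_set W) u| = n_free_nb adj W u.
Proof. by apply: eq_card => x; rewrite !inE andbC. Qed.

Lemma frozenE W L l x : size L = size W -> x \in W -> frozen W L x = fixed_col W L l x.
Proof. by move=> sL xW; rewrite ffunE /fixed_col; apply: set_nth_default; rewrite sL index_mem. Qed.

Lemma good_colP W L u l : size L = size W ->
  good_col adj W L u l -> good (fixed_pend W (frozen W L) u) l.
Proof.
move=> sL h; rewrite /good -map_comp; apply/mapP => -[x].
rewrite mem_filter => /andP [ax xW] /= e.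
by apply: (h x); [rewrite /fixed_nb ax | rewrite -frozenE].
Qed.

Lemma count_bad eps W L u l : uniq W -> size L = size W ->
  count (is_bad eps l) (fixed_pend W (frozen W L) u) = m_bad adj w eps W L u l.
Proof.
move=> uW sL; rewrite count_map count_filter -size_filter /m_bad.
rewrite -(card_uniqP (filter_uniq _ uW)); apply: eq_card => x.
rewrite !inE mem_filter /fixed_nb /= /is_bad /=.
case: (boolP (x \in W)) => xW; last by rewrite !andbF.
by rewrite (frozenE l sL xW) !andbT andbC.
Qed.

Lemma nonbad eps W L u l : uniq W -> size L = size W ->
  ~ bad_col adj w eps W L u l -> ~~ has (is_bad eps l) (fixed_pend W (frozen W L) u).
Proof.
move=> uW sL nb; rewrite has_count count_bad //.
apply/negP => /card_gt0P [x]; rewrite inE => /and3P [h1 h2 /eqP h3].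
by apply: nb; exists x; split=> //; split=> //; move: h2; case: Rle_dec.
Qed.

End FixedVertices.

(** * Transfer to restricted partition functions *)

Theorem theorem5p1 (Delta k : nat) (eps K : R) :
  (3 <= Delta)%N -> (Delta < k)%N ->
  (0 < eps < 1) -> (0 < K < 1) ->
  let theta := asin K in
  (0 < theta < PI / (3 * (INR Delta - 1 + eps))) ->
  (forall d : nat, (d <= Delta - 2)%N ->
     ((1 + eps) ^ 2 * (1 + K) ^ d / denom Delta d k eps K theta <= K)) ->
  (forall d : nat, (d <= Delta - 1)%N ->
     ((1 + eps) * (1 + K) ^ d / denom Delta d k eps K theta
        <= K / fdK d K ((INR d + (INR Delta - INR d) * eps) * theta))) ->
  forall (n : nat) (adj : rel 'I_n) (w : 'I_n -> 'I_n -> cplx),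
  simple_graph adj -> max_deg_le adj Delta ->
  (forall u v : 'I_n, (u < v)%N -> adj u v ->
     (Cnorm (w u v) <= eps) \/
     ((Cabs_arg (w u v) <= eps * theta) /\ (eps < Cnorm (w u v) <= 1))) ->
  (* (A') *)
  (forall (W : seq 'I_n) (L : seq 'I_k),
     uniq W -> leaf_independent adj W -> size L = size W ->
     Zr adj w W L <> C0) /\
  (* (B') *)
  (forall (W' : seq 'I_n) (u : 'I_n) (L' : seq 'I_k) (l l' : 'I_k),
     uniq (rcons W' u) -> leaf_independent adj (rcons W' u) ->
     size L' = size W' ->
     (Cangle (Zr adj w (rcons W' u) (rcons L' l))
             (Zr adj w (rcons W' u) (rcons L' l')) <= theta) /\
     (Cnorm (Zr adj w (rcons W' u) (rcons L' l))
        / Cnorm (Zr adj w (rcons W' u) (rcons L' l')) <= 1 + K)) /\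
  (* (cplx') *)
  (forall (W' : seq 'I_n) (u : 'I_n) (L' : seq 'I_k),
     uniq (rcons W' u) -> leaf_independent adj W' -> size L' = size W' ->
     let d := n_free_nb adj W' u in
     let GN := fun l => good_col adj W' L' u l \/ neutral_col adj w eps W' L' u l in
     (forall l, GN l -> Zr adj w (rcons W' u) (rcons L' l) <> C0) /\
     (forall l l', GN l -> GN l' ->
        (Cangle (Zr adj w (rcons W' u) (rcons L' l))
                (Zr adj w (rcons W' u) (rcons L' l'))
           <= (INR d + (INR Delta - INR d) * eps) * theta)) /\
     (forall l j, good_col adj W' L' u j ->
        (Cnorm (Zr adj w (rcons W' u) (rcons L' l))
           / Cnorm (Zr adj w (rcons W' u) (rcons L' j))
           <= eps ^ (m_bad adj w eps W' L' u l) * (1 + K) ^ d))).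
Proof.
move=> D3 Dk heps hK theta hth cond1 cond2 n adj w sg maxd hw.
have k0 : (0 < k)%N by apply: leq_ltn_trans Dk.
pose c0 : 'I_k := Ordinal k0.
have pi := PI_RGT_0.
have rD : 3 <= INR Delta.
  have -> : 3 = INR 3 by rewrite /=; ring.
  by apply: le_INR; apply/leP.
have th3 : (INR Delta - 1 + eps) * theta <= PI / 3.
  have := Rmult_lt_compat_l (INR Delta - 1 + eps) _ _ (ltac:(lra)) (proj2 hth).
  have -> : (INR Delta - 1 + eps) * (PI / (3 * (INR Delta - 1 + eps))) = PI / 3 by field; lra.
  lra.
(* For Delta >= 3, Delta <= (3 / 2) (Delta - 1). *)
have th2 : INR Delta * theta <= PI / 2 by nra.
have den0 d : (d <= Delta)%N -> 0 < denom Delta d k eps K theta.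
  by apply: denom_gt0 => //; apply: cond2.
have {}cond1 d : (d <= Delta - 2)%N -> (1 + eps) ^ 2 * (1 + K) ^ d <= K * denom Delta d k eps K theta.
  move=> hd; have N0 := den0 d (leq_trans hd (leq_subr _ _)).
  have := Rmult_le_compat_r _ _ _ (Rlt_le _ _ N0) (cond1 d hd).
  by rewrite /Rdiv Rmult_assoc Rinv_l ?Rmult_1_r; lra.
have {}cond2 d : (d <= Delta - 1)%N ->
    (1 + eps) * (1 + K) ^ d * fdK d K (phi_d Delta eps theta d) <= K * denom Delta d k eps K theta.
  move=> hd; have N0 := den0 d (leq_trans hd (leq_subr _ _)).
  have dD : (d < Delta)%N by move: hd; rewrite subn1 -ltnS prednK //; apply: leq_trans D3.
  have [ph0 ph3] := phi_d_bounds heps (proj1 hth) th3 dD.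
  have f0 : 0 < fdK d K (phi_d Delta eps theta d).
    by apply: Rlt_le_trans (fdK_sin _ _ _); have := sin_gt_0 (phi_d Delta eps theta d / 2); lra.
  have := Rmult_le_compat_r _ _ _ (Rlt_le _ _ (Rmult_lt_0_compat _ _ N0 f0)) (cond2 d hd).
  rewrite -/(phi_d Delta eps theta d); set N := denom _ _ _ _ _ _ in N0 *; set f := fdK _ _ _ in f0 *.
  have -> : (1 + eps) * (1 + K) ^ d / N * (N * f) = (1 + eps) * (1 + K) ^ d * f by field; lra.
  by have -> : K / f * (N * f) = K * N by field; lra.
have wok u v : adj u v -> okw eps theta (wt w u v).
  move=> auv; have : (Cnorm (wt w u v) <= eps) \/
     ((Cabs_arg (wt w u v) <= eps * theta) /\ (eps < Cnorm (wt w u v) <= 1)).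
    rewrite /wt; case: (ltngtP u v) => uv; first exact: hw.
      by apply: hw => //; rewrite (proj1 sg).
    by move: auv; rewrite (val_inj uv) (proj2 sg).
  case=> [|[h1 h2]]; first by left.
  right; split=> //.
  have [|t ht e] := @polar_exists (wt w u v); first by apply: Cnorm_gt0_neq0; lra.
  by exists t; rewrite ?ht.
have stS S : stable Delta k adj w eps K theta S.
  exact: (all_stable sg Dk heps hK erefl (proj1 hth) th3 th2 den0 cond1 cond2 wok).
have val (W : seq 'I_n) (L : seq 'I_k) : uniq W ->
    valid Delta adj eps theta (free_set W) (fixed_pend adj w W (frozen c0 W L)).
  move=> uW v vS; split; first by rewrite size_fixed_pend.
  rewrite /ok_pend; move: (frozen _ _ _) => psi; elim: (W) => [|x W' IH] /=; first by constructor.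
  rewrite /fixed_pend /=; case: (boolP (adj v x)) => a //=.
  by constructor=> //=; apply: wok.
(* A common source for (B') and (C'). The angle involves the actual number of fixed neighbours of
   [u] rather than Delta - d, so that a leaf with a free neighbour gets exactly theta. *)
have main (W : seq 'I_n) (L : seq 'I_k) (u : 'I_n) : uniq (rcons W u) ->
   (forall x y, x \in W -> y \in W -> adj x y = false) ->
   size L = size W ->
   [/\ forall l, ~ bad_col adj w eps W L u l -> Zr adj w (rcons W u) (rcons L l) <> C0,
       forall l l', ~ bad_col adj w eps W L u l -> ~ bad_col adj w eps W L u l' ->
         Cangle (Zr adj w (rcons W u) (rcons L l)) (Zr adj w (rcons W u) (rcons L l'))
           <= (INR (n_free_nb adj W u) + INR (deg adj u - n_free_nb adj W u) * eps) * theta &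
       forall l j, good_col adj W L u j ->
        Cnorm (Zr adj w (rcons W u) (rcons L l)) / Cnorm (Zr adj w (rcons W u) (rcons L j))
           <= eps ^ (m_bad adj w eps W L u l) * (1 + K) ^ n_free_nb adj W u].
  move=> uWu ind sL; have := uWu; rewrite rcons_uniq => /andP [uW' uW].
  have uS : u \in free_set W by rewrite inE.
  have [] := Zpend_at_ratio sg heps (proj1 hth) wok (frozen c0 W L) uS (val W L uW) (stS _).
  have := size_fixed_pend adj w (frozen c0 W L) u uW.
  rewrite nbrs_free => hsz h1 h2 h3.
  have psz : size (fixed_pend adj w W (frozen c0 W L) u) = (deg adj u - n_free_nb adj W u)%N.
    by rewrite -hsz addKn.
  have angle_le : (INR (n_free_nb adj W u) + INR (deg adj u - n_free_nb adj W u) * eps) * theta <= PI.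
    have : INR (n_free_nb adj W u) + INR (deg adj u - n_free_nb adj W u) <= INR Delta.
      rewrite -plus_INR; apply: le_INR; apply/leP; rewrite plusE subnKC; first exact: maxd.
      by rewrite -hsz leq_addr.
    have := pos_INR (deg adj u - n_free_nb adj W u) => p0 hle.
    apply: Rle_trans (_ : INR Delta * theta <= _); last lra.
    by apply: Rmult_le_compat_r; nra.
  split.
  - by move=> l nb; rewrite (Zr_rcons w c0 sg) //; apply: h1; apply: nonbad.
  - move=> l l' nb nb'; rewrite !(Zr_rcons w c0 sg) //.
    have [rho nr] := h2 l l' (nonbad c0 uW sL nb) (nonbad c0 uW sL nb').
    rewrite psz in nr; apply: Cangle_near angle_le nr.
    by apply: h1; apply: nonbad.
  move=> l j gj; rewrite !(Zr_rcons w c0 sg) //.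
  have := h3 l j (good_colP w c0 sL gj); rewrite count_bad // => h.
  have j0 : Zpend_at adj w (free_set W) (frozen c0 W L) (fixed_pend adj w W (frozen c0 W L)) u j <> C0.
    by apply: h1; apply: nonbad => // -[v [h4 [_ h5]]]; apply: (gj v).
  apply: (Rmult_le_reg_r _ _ _ (Cnorm_gt0 j0)).
  by rewrite /Rdiv Rmult_assoc Rinv_l ?Rmult_1_r //; have := Cnorm_gt0 j0; lra.
split; last split.
- move=> W L uW [ind _] sL; rewrite (Zr_Zpend w c0 sg) //.
  by have [] := stS _ (frozen c0 W L) _ (val W L uW).
- move=> W u L l l' uWu [ind leaf] sL.
  have ind' x y : x \in W -> y \in W -> adj x y = false.
    by move=> xW yW; apply: ind; rewrite mem_rcons inE ?xW ?yW orbT.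
  (* Independence of W'u leaves [u] without fixed neighbours: every colour is good, and its only
     neighbour is free, so d = 1. *)
  have nu v : fixed_nb adj W u v -> False.
    by case/andP => + vW; rewrite ind // mem_rcons inE ?eqxx ?vW ?orbT.
  have d1 : deg adj u = 1%N by apply: leaf; rewrite mem_rcons mem_head.
  have f1 : n_free_nb adj W u = 1%N.
    rewrite -d1; apply: eq_card => v; rewrite !inE; case: (boolP (adj u v)) => //= a.
    by apply/negP => vW; apply: (nu v); rewrite /fixed_nb a.
  have nb i : ~ bad_col adj w eps W L u i by case=> v [/nu].
  have [_ h2 h3] := main W L u uWu ind' sL; split.
    by have := h2 l l' (nb _) (nb _); rewrite d1 f1 subnn /=; lra.
  have := h3 l l' (fun v h => False_ind _ (nu v h)); rewrite f1 -[(1 + K) ^ 1]/((1 + K) * 1).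
  have -> : m_bad adj w eps W L u l = 0%N.
    by apply: eq_card0 => v; rewrite !inE; apply/negP => /andP [/nu].
  by rewrite /=; lra.
move=> W u L uWu [ind leaf] sL d GN.
have [h1 h2 h3] := main W L u uWu ind sL.
have GNb l : GN l -> ~ bad_col adj w eps W L u l.
  by case=> [g [v [h4 [_ h5]]]|[_ //]]; apply: (g v).
split; first by move=> l /GNb; apply: h1.
split; last exact: h3.
move=> l l' /GNb g /GNb g'; apply: Rle_trans (h2 l l' g g') _; rewrite -/d.
apply: Rmult_le_compat_r; first lra; apply: Rplus_le_compat_l; apply: Rmult_le_compat_r; first lra.
have dle : (d <= deg adj u)%N.
  by apply: subset_leq_card; apply/subsetP => v; rewrite !inE => /andP [].
rewrite -minusE minus_INR; last by apply/leP.
by have /leP/le_INR := maxd u; lra.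
Qed.
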